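(* Let $(\widetilde N,\langle\cdot,\cdot\rangle)$ be a connected and simply connected cyclic Riemannian nilmanifold without Euclidean factor, i.e. its Lie algebra $\mathfrak{n}$ satisfies $\mathfrak{z}=[\mathfrak{n},\mathfrak{n}]$, where $\mathfrak{z}$ is the center of $\mathfrak{n}$. With the notation $k$, $r_p$, $Z_p$, $X_{pi}$, $Y_{pi}$, $H$, $H_0$, $\widetilde\Gamma$ of the context, the isotropy subgroup $H$ (at the identity) of the full isometry group of $(\widetilde N,\langle\cdot,\cdot\rangle)$ is $$H=\widetilde\Gamma\cdot H_0,$$ where $H_0$ is a compact connected normal subgroup of $H$ with $$H_0\cong U(r_1)\times\cdots\times U(r_k),$$ each factor $U(r_p)$ acting on $\mathfrak{a}_p^{r_p}\cong\mathbb{C}^{r_p}$ by its standard matrix action and $H_0$ acting trivially on $\mathfrak{z}$, and $\widetilde\Gamma$ is a finite group. In particular, $$\dim H=\sum_{p=1}^{k}r_p^{2},$$ and the component group $H/H_0$, via its action $(T,\varphi)\mapsto\varphi$ on $\mathfrak{z}$, is a subgroup of the group of signed permutations of $\{\pm Z_1,\dots,\pm Z_k\}$ that preserve the multiplicities $r_p$ and the norms $\|Z_p\|$ (that is, if $Z_p$ is sent to $\pm Z_q$ then $r_p=r_q$ and $\|Z_p\|=\|Z_q\|$).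
   Context: Riemannian nilmanifold: a connected nilpotent Lie group with a left-invariant Riemannian metric. Cyclic: a connected homogeneous Riemannian manifold $(M,g)$ is cyclic if there are a connected Lie group $G$ acting transitively and effectively on $M$ by isometries, with isotropy subgroup $K$ at a point $p$ and Lie algebras $\mathfrak{g},\mathfrak{k}$, and a vector space decomposition $\mathfrak{g}=\mathfrak{k}\oplus\mathfrak{m}$ with $\operatorname{Ad}(K)\mathfrak{m}\subset\mathfrak{m}$, such that $\langle [X,Y]_{\mathfrak{m}},Z\rangle+\langle [Y,Z]_{\mathfrak{m}},X\rangle+\langle [Z,X]_{\mathfrak{m}},Y\rangle=0$ for all $X,Y,Z\in\mathfrak{m}$. Here $[\cdot,\cdot]_{\mathfrak{m}}$ is the projection of the bracket onto $\mathfrak{m}$ along $\mathfrak{k}$, and $\langle\cdot,\cdot\rangle$ is the inner product on $\mathfrak{m}\cong T_pM$ induced by $g$. $J$-map: for a Lie algebra $\mathfrak{n}$ with inner product and $[\mathfrak{n},[\mathfrak{n},\mathfrak{n}]]=\{0\}$, let $\mathfrak{z}$ be its center and $\mathfrak{a}=\mathfrak{z}^\perp$. The linear map $J:\mathfrak{z}\to\mathfrak{so}(\mathfrak{a})$ is given by $\langle J_ZX,Y\rangle=\langle[X,Y],Z\rangle$ for $X,Y\in\mathfrak{a}$, $Z\in\mathfrak{z}$, and $J_{\mathfrak{z}}=\{J_Z:Z\in\mathfrak{z}\}$. The condition $\mathfrak{z}=[\mathfrak{n},\mathfrak{n}]$ (''no Euclidean factor'') is equivalent to injectivity of $J$. The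 Lie algebra $\mathfrak{n}$ of a cyclic Riemannian nilmanifold satisfies $[\mathfrak{n},[\mathfrak{n},\mathfrak{n}]]=\{0\}$ and its $J_{\mathfrak{z}}$ is Abelian, i.e. the $J_Z$ commute pairwise (a result of the same paper); the following notation relies on this. Isotypic decomposition: there is a $J_{\mathfrak{z}}$-invariant orthogonal decomposition $\mathfrak{a}=\mathfrak{a}_1^{r_1}\oplus\cdots\oplus\mathfrak{a}_k^{r_k}$ into isotypic components $\mathfrak{a}_p^{r_p}=\mathfrak{a}_{p1}\oplus\cdots\oplus\mathfrak{a}_{pr_p}$ (orthogonal sum), where each $\mathfrak{a}_{pi}$ is an irreducible real two-dimensional $J_{\mathfrak{z}}$-module, and $\mathfrak{a}_{pi}\cong\mathfrak{a}_{qj}$ if and only if $p=q$. For each $p$ fix a nonzero weight $\lambda_p\in\mathfrak{z}^*$ (determined up to sign) and orthonormal bases $\{X_{pi},Y_{pi}\}$ of $\mathfrak{a}_{pi}$ with $J_ZX_{pi}=\lambda_p(Z)Y_{pi}$ and $J_ZY_{pi}=-\lambda_p(Z)X_{pi}$ for all $Z\in\mathfrak{z}$. Thus $\lambda_p\neq\pm\lambda_q$ for $p\ne q$. Let $Z_p\in\mathfrak{z}$ be defined by $\langle Z_p,Z\rangle=\lambda_p(Z)$ for all $Z\in\mathfrak{z}$. Each $\mathfrak{a}_{pi}$ is identified with $\mathbb{C}$ via the complex structure $I_pX_{pi}=Y_{pi}$, $I_pY_{pi}=-X_{pi}$ (with $X_{pi}$ corresponding to $1$), so $\mathfrak{a}_p^{r_p}\cong\mathbb{C}^{r_p}$.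 Groups: the full isometry group of $(\widetilde N,\langle\cdot,\cdot\rangle)$ is $H\ltimes\widetilde N$, where the isotropy subgroup $H$ at the identity is identified (via differentials at the identity) with $$H=\operatorname{Aut}(\mathfrak{n})\cap O(\mathfrak{n})=\{(T,\varphi)\in O(\mathfrak{a})\times O(\mathfrak{z}) : J_{\varphi(Z)}=TJ_ZT^{-1}\ \text{for all }Z\in\mathfrak{z}\}.$$ Set $H_0=\{(T,\varphi)\in H:\varphi=\mathrm{Id}\}$. Let $\Gamma$ be the group of all $\varphi\in O(\mathfrak{z})$ such that for every $p$ there is a $q$ with $r_p=r_q$ and $\varphi(Z_p)=\pm Z_q$. For $\varphi\in\Gamma$ let $T_\varphi\in O(\mathfrak{a})$ be given as follows: if $\varphi(Z_p)=Z_q$, then $T_\varphi X_{pi}=X_{qi}$ and $T_\varphi Y_{pi}=Y_{qi}$ for all $i$; if $\varphi(Z_p)=-Z_q$, then $T_\varphi X_{pi}=X_{qi}$ and $T_\varphi Y_{pi}=-Y_{qi}$ for all $i$. Set $\widetilde\Gamma=\{(T_\varphi,\varphi):\varphi\in\Gamma\}$. *)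

(* Defs.v *)
From HB Require Import structures.
From mathcomp Require Import all_boot all_order all_algebra all_fingroup.
From mathcomp Require Import complex.
From mathcomp Require Import all_classical all_reals all_analysis.
Import Order.TTheory GRing.Theory Num.Theory.
Import numFieldNormedType.Exports.
Set Implicit Arguments.
Unset Strict Implicit.
Unset Printing Implicit Defensive.
Local Open Scope classical_set_scope.
Local Open Scope ring_scope.

(* [f] is of class C^k at the points of the open set [U]. *)
Fixpoint class_C (R : realType) (V W : normedModType R) (k : nat)
    (U : set V) (f : V -> W) : Prop :=
  match k with
  | 0 => forall x, U x -> {for x, continuous f}
  | k'.+1 => (forall x, U x -> differentiable f x) /\
             (forall v, class_C k' U (fun x => 'd f x v))
  end.

Definition smooth_on (R : realType) (V W : normedModType R)
    (U : set V) (f : V -> W) : Prop :=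
  forall k, class_C k U f.

(* The maps are only meaningful on [cdom] and on [cmap @` cdom]; their values
   elsewhere are junk. *)
Record chart (R : realType) (d : nat) (M : Type) := Chart {
  cdom : set M;
  cmap : M -> 'cV[R]_d;
  cinv : 'cV[R]_d -> M }.

Definition is_chart (R : realType) (d : nat) (M : topologicalType)
    (c : chart R d M) : Prop :=
  [/\ open (cdom c),
      open (cmap c @` cdom c),
      (forall x, cdom c x -> cinv c (cmap c x) = x),
      (forall x, cdom c x -> {for x, continuous (cmap c)}) &
      (forall y, (cmap c @` cdom c) y -> {for y, continuous (cinv c)})].

Definition is_manifold (R : realType) (d : nat) (M : topologicalType)
    (atlas : set (chart R d M)) : Prop :=
  [/\ hausdorff_space M,
      @second_countable M,
      (forall c, atlas c -> is_chart c),
      (forall x, exists2 c, atlas c & cdom c x) &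
      (forall c c', atlas c -> atlas c' ->
         smooth_on (cmap c @` (cdom c `&` cdom c')) (cmap c' \o cinv c))].

Definition smooth_map (R : realType) (d d' : nat) (M M' : topologicalType)
    (atlas : set (chart R d M)) (atlas' : set (chart R d' M'))
    (f : M -> M') : Prop :=
  continuous f /\
  forall c c', atlas c -> atlas' c' ->
    smooth_on (cmap c @` (cdom c `&` f @^-1` cdom c'))
              (cmap c' \o f \o cinv c).

Definition smooth_map2 (R : realType) (d1 d2 d3 : nat)
    (M1 M2 M3 : topologicalType) (atlas1 : set (chart R d1 M1))
    (atlas2 : set (chart R d2 M2)) (atlas3 : set (chart R d3 M3))
    (f : M1 -> M2 -> M3) : Prop :=
  continuous (fun p : M1 * M2 => f p.1 p.2) /\
  forall c1 c2 c3, atlas1 c1 -> atlas2 c2 -> atlas3 c3 ->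
    smooth_on
      [set q : 'cV[R]_d1 * 'cV[R]_d2 |
        exists x1 x2, [/\ cdom c1 x1, cdom c2 x2, cdom c3 (f x1 x2) &
                          q = (cmap c1 x1, cmap c2 x2)]]
      (fun q => cmap c3 (f (cinv c1 q.1) (cinv c2 q.2))).

(* A Lie group of dimension [d].  The chart [lg_chart] around the identity is
   only used to identify the tangent space at the identity with ['cV[R]_d]. *)
Record lie_group (R : realType) (d : nat) := LieGroup {
  lg_space :> topologicalType;
  lg_atlas : set (chart R d lg_space);
  lg_one : lg_space;
  lg_mul : lg_space -> lg_space -> lg_space;
  lg_inv : lg_space -> lg_space;
  lg_chart : chart R d lg_space;
  lg_manifold : is_manifold lg_atlas;
  lg_mulA : associative lg_mul;
  lg_mul1g : left_id lg_one lg_mul;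
  lg_mulVg : left_inverse lg_one lg_inv lg_mul;
  lg_mul_smooth : smooth_map2 lg_atlas lg_atlas lg_atlas lg_mul;
  lg_inv_smooth : smooth_map lg_atlas lg_atlas lg_inv;
  lg_chart_atlas : lg_atlas lg_chart;
  lg_chart_one : cdom lg_chart lg_one }.

Arguments lg_atlas {R d} _.

Definition lg_base (R : realType) (d : nat) (G : lie_group R d) : 'cV[R]_d :=
  cmap (lg_chart G) (lg_one G).

(* Differential at the identity of a map [f] fixing the identity. *)
Definition diff_one (R : realType) (d d' : nat)
    (G : lie_group R d) (G' : lie_group R d') (f : G -> G') :
    'cV[R]_d -> 'cV[R]_d' :=
  'd (cmap (lg_chart G') \o f \o cinv (lg_chart G)) (lg_base G).

Definition lg_mul_coord (R : realType) (d : nat) (G : lie_group R d)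
    (q : 'cV[R]_d * 'cV[R]_d) : 'cV[R]_d :=
  cmap (lg_chart G) (lg_mul (cinv (lg_chart G) q.1) (cinv (lg_chart G) q.2)).

(* The bracket of left-invariant vector fields, at the identity: writing mu for
   the group law in coordinates, [u, v] is the antisymmetrisation of the mixed
   second derivative D_1 D_2 mu (u, v) at (e, e). *)
Definition lie_bracket (R : realType) (d : nat) (G : lie_group R d)
    (u v : 'cV[R]_d) : 'cV[R]_d :=
  let mu := @lg_mul_coord R d G in
  let e2 := (lg_base G, lg_base G) in
  'd (fun q => 'd mu q (0, v)) e2 (u, 0) -
  'd (fun q => 'd mu q (0, u)) e2 (v, 0).

(* Velocities at the identity of the curves of [G] contained in [K]; this is
   the Lie algebra of [K] when [K] is a closed subgroup. *)
Definition subgroup_lie_algebra (R : realType) (d : nat) (G : lie_group R d)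
    (K : set G) : set 'cV[R]_d :=
  [set u | exists gamma : R -> G,
    [/\ gamma 0 = lg_one G, (forall t, K (gamma t)),
        {for 0, continuous gamma} &
        is_derive (0 : R) (1 : R) (cmap (lg_chart G) \o gamma) u]].

Definition Ad (R : realType) (d : nat) (G : lie_group R d) (g : G) :
    'cV[R]_d -> 'cV[R]_d :=
  diff_one (G := G) (G' := G) (fun x => lg_mul (lg_mul g x) (lg_inv g)).

Fixpoint upper_central (R : realType) (d : nat) (G : lie_group R d)
    (c : nat) : set G :=
  match c with
  | 0 => [set lg_one G]
  | c'.+1 => [set x | forall y,
      upper_central c' (lg_mul (lg_mul (lg_inv x) (lg_inv y)) (lg_mul x y))]
  end.

Definition nilpotent_group (R : realType) (d : nat) (G : lie_group R d) :
    Prop :=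
  exists c, upper_central (G := G) c = [set: G].

Definition simply_connected (R : realType) (M : topologicalType) : Prop :=
  forall gamma : R -> M,
    {within `[0, 1], continuous gamma} -> gamma 0 = gamma 1 ->
    exists h : R * R -> M,
      {within (`[0, 1]%classic `*` `[0, 1]%classic), continuous h} /\
      forall t : R, 0 <= t <= 1 ->
        [/\ h (t, 0) = gamma t, h (t, 1) = gamma 0,
            h (0, t) = gamma 0 & h (1, t) = gamma 0].

Definition inner_product (R : realType) (n : nat)
    (ip : 'cV[R]_n -> 'cV[R]_n -> R) : Prop :=
  [/\ (forall a x y z, ip (a *: x + y) z = a * ip x z + ip y z),
      (forall x y, ip x y = ip y x) &
      (forall x, x != 0 -> 0 < ip x x)].

(* Isometries of [N] with the left-invariant metric given by [ip] at the
   identity.  Left translations being isometries, d_x f preserves the metric if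
   and only if the differential at the identity of L_{f x}^{-1} o f o L_x
   preserves [ip]. *)
Definition is_isometry (R : realType) (n : nat) (N : lie_group R n)
    (ip : 'cV[R]_n -> 'cV[R]_n -> R) (f : N -> N) : Prop :=
  [/\ bijective f, smooth_map (lg_atlas N) (lg_atlas N) f &
      forall x u v,
        let F := diff_one (G := N) (G' := N)
                   (fun y => lg_mul (lg_inv (f x)) (f (lg_mul x y))) in
        ip (F u) (F v) = ip u v].

Definition transitive_effective_isometric (R : realType) (d n : nat)
    (G : lie_group R d) (N : lie_group R n)
    (ip : 'cV[R]_n -> 'cV[R]_n -> R) (alpha : G -> N -> N) : Prop :=
  [/\ (forall x, alpha (lg_one G) x = x) /\
      (forall g g' x, alpha (lg_mul g g') x = alpha g (alpha g' x)),
      smooth_map2 (lg_atlas G) (lg_atlas N) (lg_atlas N) alpha,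
      (forall g, is_isometry ip (alpha g)),
      (forall x y, exists g, alpha g x = y) &
      (forall g, (forall x, alpha g x = x) -> g = lg_one G)].

(* The differential at the identity of the orbit map g |-> g.p, followed by
   the isometry T_p N -> T_e N given by the left translation by p^-1. *)
Definition orbit_diff (R : realType) (d n : nat)
    (G : lie_group R d) (N : lie_group R n) (alpha : G -> N -> N) (p : N) :
    'cV[R]_d -> 'cV[R]_n :=
  diff_one (G := G) (G' := N) (fun g => lg_mul (lg_inv p) (alpha g p)).

(* [daddv_pi m k] is the projection onto m along k. *)
Definition cyclic (R : realType) (n : nat) (N : lie_group R n)
    (ip : 'cV[R]_n -> 'cV[R]_n -> R) : Prop :=
  exists (d : nat) (G : lie_group R d) (alpha : G -> N -> N) (p : N)
         (k m : {vspace 'cV[R]_d}),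
    let K := [set g | alpha g p = p] in
    let br u v := daddv_pi m k (lie_bracket G u v) in
    let ipm u v := ip (orbit_diff alpha p u) (orbit_diff alpha p v) in
    [/\ connected [set: G] /\ transitive_effective_isometric ip alpha,
        (forall u, u \in k <-> subgroup_lie_algebra K u),
        (k + m)%VS = fullv /\ (k :&: m)%VS = 0%VS,
        (forall g, K g -> forall u, u \in m -> Ad g u \in m) &
        (forall x y z, x \in m -> y \in m -> z \in m ->
           ipm (br x y) z + ipm (br y z) x + ipm (br z x) y = 0)].

(* Below, [br] is the bracket and [ip] the inner product of a Lie algebra with
   underlying space ['cV[R]_n]. *)

Definition lie_center (R : realType) (n : nat)
    (br : 'cV[R]_n -> 'cV[R]_n -> 'cV[R]_n) : set 'cV[R]_n :=
  [set z | forall x, br z x = 0].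

Definition lie_derived (R : realType) (n : nat)
    (br : 'cV[R]_n -> 'cV[R]_n -> 'cV[R]_n) : set 'cV[R]_n :=
  [set x | exists (l : nat) (u v : 'I_l -> 'cV[R]_n),
     x = \sum_(i < l) br (u i) (v i)].

Definition orthogonal_to (R : realType) (n : nat)
    (ip : 'cV[R]_n -> 'cV[R]_n -> R) (S : set 'cV[R]_n) : set 'cV[R]_n :=
  [set x | forall z, S z -> ip x z = 0].

(* [J Z X] stands for J_Z X; it is only specified for Z in z and X in a. *)
Definition is_Jmap (R : realType) (n : nat)
    (br : 'cV[R]_n -> 'cV[R]_n -> 'cV[R]_n)
    (ip : 'cV[R]_n -> 'cV[R]_n -> R)
    (J : 'cV[R]_n -> 'cV[R]_n -> 'cV[R]_n) : Prop :=
  let z := lie_center br in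
  let a := orthogonal_to ip z in
  forall Z X, z Z -> a X ->
    a (J Z X) /\ forall Y, a Y -> ip (J Z X) Y = ip (br X Y) Z.

Definition Jinvariant (R : realType) (n : nat) (z : set 'cV[R]_n)
    (J : 'cV[R]_n -> 'cV[R]_n -> 'cV[R]_n) (W : {vspace 'cV[R]_n}) : Prop :=
  forall Z x, z Z -> x \in W -> J Z x \in W.

Definition Jirreducible (R : realType) (n : nat) (z : set 'cV[R]_n)
    (J : 'cV[R]_n -> 'cV[R]_n -> 'cV[R]_n) (W : {vspace 'cV[R]_n}) : Prop :=
  [/\ Jinvariant z J W, W <> 0%VS &
      forall U : {vspace 'cV[R]_n}, (U <= W)%VS -> Jinvariant z J U ->
        U = 0%VS \/ U = W].

Definition Jisomorphic (R : realType) (n : nat) (z : set 'cV[R]_n)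
    (J : 'cV[R]_n -> 'cV[R]_n -> 'cV[R]_n) (W W' : {vspace 'cV[R]_n}) : Prop :=
  exists f : 'End('cV[R]_n),
    [/\ (f @: W)%VS = W', (W :&: lker f)%VS = 0%VS &
        forall Z x, z Z -> x \in W -> f (J Z x) = J Z (f x)].

(* Isotypic decomposition of a = z^perp with its adapted orthonormal bases
   [X p i], [Y p i] and weights [lam p]. *)
Definition isotypic_decomposition (R : realType) (n : nat)
    (br : 'cV[R]_n -> 'cV[R]_n -> 'cV[R]_n)
    (ip : 'cV[R]_n -> 'cV[R]_n -> R)
    (J : 'cV[R]_n -> 'cV[R]_n -> 'cV[R]_n)
    (k : nat) (r : 'I_k -> nat)
    (X Y : forall p : 'I_k, 'I_(r p) -> 'cV[R]_n)
    (lam : 'I_k -> 'cV[R]_n -> R) : Prop :=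
  let z := lie_center br in
  let a := orthogonal_to ip z in
  let plane p i := (<[X p i]> + <[Y p i]>)%VS in
  [/\ (forall p, (0 < r p)%N),
      (forall x, a x <-> x \in (\sum_(p < k) \sum_(i < r p) plane p i)%VS),
      (forall p (i : 'I_(r p)) q (j : 'I_(r q)),
         let delta : R := ((p == q) && (i == j :> nat))%:R in
         [/\ ip (X p i) (X q j) = delta, ip (Y p i) (Y q j) = delta &
             ip (X p i) (Y q j) = 0]),
      (forall p i, Jirreducible z J (plane p i)) /\
      (forall p i q j, Jisomorphic z J (plane p i) (plane q j) <-> p = q) &
      (forall p,
         [/\ (forall c Z Z', z Z -> z Z' ->
                lam p (c *: Z + Z') = c * lam p Z + lam p Z'),
             (exists2 Z, z Z & lam p Z <> 0) &
             forall i Z, z Z ->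
               J Z (X p i) = lam p Z *: Y p i /\
               J Z (Y p i) = - lam p Z *: X p i])].

Definition is_weight_vector (R : realType) (n : nat)
    (br : 'cV[R]_n -> 'cV[R]_n -> 'cV[R]_n)
    (ip : 'cV[R]_n -> 'cV[R]_n -> R)
    (k : nat) (lam : 'I_k -> 'cV[R]_n -> R) (Zw : 'I_k -> 'cV[R]_n) : Prop :=
  forall p, lie_center br (Zw p) /\
            forall Z, lie_center br Z -> ip (Zw p) Z = lam p Z.

(* The pair (T, phi) in O(a) x O(z) is encoded by the endomorphism T + phi of
   n = a + z, i.e. by a matrix acting on columns. *)

(* H = Aut(n) /\ O(n). *)
Definition isotropy (R : realType) (n : nat)
    (br : 'cV[R]_n -> 'cV[R]_n -> 'cV[R]_n)
    (ip : 'cV[R]_n -> 'cV[R]_n -> R) : set 'M[R]_n :=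
  [set A | [/\ A \in unitmx,
               (forall x y, A *m br x y = br (A *m x) (A *m y)) &
               (forall x y, ip (A *m x) (A *m y) = ip x y)]].

Definition isotropy0 (R : realType) (n : nat)
    (br : 'cV[R]_n -> 'cV[R]_n -> 'cV[R]_n)
    (ip : 'cV[R]_n -> 'cV[R]_n -> R) : set 'M[R]_n :=
  [set A | isotropy br ip A /\ forall Z, lie_center br Z -> A *m Z = Z].

(* Only the restriction of [phi] to z matters. *)
Definition Gamma (R : realType) (n : nat)
    (br : 'cV[R]_n -> 'cV[R]_n -> 'cV[R]_n)
    (ip : 'cV[R]_n -> 'cV[R]_n -> R)
    (k : nat) (r : 'I_k -> nat) (Zw : 'I_k -> 'cV[R]_n) :
    set ('cV[R]_n -> 'cV[R]_n) :=
  let z := lie_center br in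
  [set phi |
    [/\ (forall Z, z Z -> z (phi Z)),
        (forall c Z Z', z Z -> z Z' ->
           phi (c *: Z + Z') = c *: phi Z + phi Z'),
        (forall Z Z', z Z -> z Z' -> ip (phi Z) (phi Z') = ip Z Z') &
        (forall p, exists q, r p = r q /\
           (phi (Zw p) = Zw q \/ phi (Zw p) = - Zw q))]].

(* The lifts T_phi + phi of the elements phi of Gamma. *)
Definition Gamma_lift (R : realType) (n : nat)
    (br : 'cV[R]_n -> 'cV[R]_n -> 'cV[R]_n)
    (ip : 'cV[R]_n -> 'cV[R]_n -> R)
    (k : nat) (r : 'I_k -> nat)
    (X Y : forall p : 'I_k, 'I_(r p) -> 'cV[R]_n)
    (Zw : 'I_k -> 'cV[R]_n) : set 'M[R]_n :=
  [set A | exists phi,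
    [/\ Gamma br ip r Zw phi,
        (forall Z, lie_center br Z -> A *m Z = phi Z),
        (forall p q, phi (Zw p) = Zw q ->
           forall (i : 'I_(r p)) (j : 'I_(r q)), i = j :> nat ->
             A *m X p i = X q j /\ A *m Y p i = Y q j) &
        (forall p q, phi (Zw p) = - Zw q ->
           forall (i : 'I_(r p)) (j : 'I_(r q)), i = j :> nat ->
             A *m X p i = X q j /\ A *m Y p i = - Y q j)]].

Definition matrix_group (R : realType) (n : nat) (S : set 'M[R]_n) : Prop :=
  [/\ S 1%:M,
      (forall A B, S A -> S B -> S (A *m B)) &
      (forall A, S A -> A \in unitmx /\ S (invmx A))].

Definition normal_in (R : realType) (n : nat) (S0 S : set 'M[R]_n) : Prop :=
  [/\ matrix_group S0, S0 `<=` S &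
      forall A B, S A -> S0 B -> S0 (A *m B *m invmx A)].

(* Tangent space at the identity of a closed subgroup [S] of GL_n(R), i.e. its
   Lie algebra. *)
Definition matrix_lie_algebra (R : realType) (n : nat) (S : set 'M[R]_n) :
    set 'M[R]_n :=
  [set A | exists gamma : R -> 'M[R]_n,
    [/\ gamma 0 = 1%:M, (forall t, S (gamma t)) &
        is_derive (0 : R) (1 : R) gamma A]].

(* The closed subgroup [S] of GL_n(R) has dimension [d] as a Lie group. *)
Definition has_lie_dim (R : realType) (n : nat) (S : set 'M[R]_n) (d : nat) :
    Prop :=
  exists2 s : {vspace 'M[R]_n},
    (forall A, A \in s <-> matrix_lie_algebra S A) & \dim s = d.

(* [R[i]^o] is [R[i]] with the topology given by the modulus. *)
Notation cmx_family R r :=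
  (prod_topology (fun p => 'M[(complex.complex R)^o]_(r p))).

Definition unitary_product (R : realType) (k : nat) (r : 'I_k -> nat) :
    set (cmx_family R r) :=
  [set u | forall p, (u p : 'M[R[i]]_(r p)) \is unitarymx].

(* The identification of C^(r_p) with the p-th isotypic component. *)
Definition from_complex (R : realType) (n : nat) (k : nat) (r : 'I_k -> nat)
    (X Y : forall p : 'I_k, 'I_(r p) -> 'cV[R]_n) (p : 'I_k)
    (w : 'cV[R[i]]_(r p)) : 'cV[R]_n :=
  \sum_(i < r p) (complex.Re (w i 0) *: X p i + complex.Im (w i 0) *: Y p i).

(* [S] is isomorphic, as a topological group, to the product of the U(r_p),
   each factor acting in the standard way on C^(r_p) and the product acting
   trivially on [z]. *)
Definition acts_as_unitary_product (R : realType) (n : nat) (k : nat)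
    (r : 'I_k -> nat) (X Y : forall p : 'I_k, 'I_(r p) -> 'cV[R]_n)
    (z : set 'cV[R]_n) (S : set 'M[R]_n) : Prop :=
  let U := unitary_product (R := R) (r := r) in
  exists (Phi : cmx_family R r -> 'M[R]_n) (Psi : 'M[R]_n -> cmx_family R r),
    [/\ [/\ set_bij U S Phi, {in U, cancel Phi Psi},
            {within U, continuous Phi} & {within S, continuous Psi}],
        (forall u v, U u -> U v -> Phi (fun p => u p *m v p) = Phi u *m Phi v),
        (forall u p w, U u ->
           Phi u *m from_complex X Y (p := p) w =
           from_complex X Y ((u p : 'M[R[i]]_(r p)) *m w)) &
        (forall u Z, U u -> z Z -> Phi u *m Z = Z)].

(* [(s, e)] sends Z_p to (-1)^(e p) Z_(s p). *)
Definition signed_perm (k : nat) : Type :=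
  ({perm 'I_k} * {ffun 'I_k -> bool})%type.

Definition signed_perm_mul (k : nat) (s t : signed_perm k) : signed_perm k :=
  ((t.1 * s.1)%g, [ffun p => t.2 p (+) s.2 (t.1 p)]).

(* The action of [S] on the vectors +-Z_p induces an isomorphism of [S / S0]
   onto a subgroup of the group of signed permutations of the +-Z_p preserving
   the multiplicities [r p] and the norms of the Z_p. *)
Definition quotient_embeds_in_signed_perms (R : realType) (n : nat)
    (ip : 'cV[R]_n -> 'cV[R]_n -> R) (k : nat) (r : 'I_k -> nat)
    (Zw : 'I_k -> 'cV[R]_n) (S S0 : set 'M[R]_n) : Prop :=
  exists rho : 'M[R]_n -> signed_perm k,
    [/\ (forall A p, S A ->
           A *m Zw p = (-1) ^+ (rho A).2 p *: Zw ((rho A).1 p)),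
        (forall A p, S A ->
           let q := (rho A).1 p in
           r p = r q /\
           Num.sqrt (ip (Zw p) (Zw p)) = Num.sqrt (ip (Zw q) (Zw q))),
        (forall A B, S A -> S B ->
           rho (A *m B) = signed_perm_mul (rho A) (rho B)) &
        (forall A B, S A -> S B ->
           rho A = rho B <-> exists2 C, S0 C & B = A *m C)].

(* Main.v *)
(* Since z = [n, n], the weights determine the bracket:
   [x, y] = sum_p omega_p(x, y) Z_p, where omega_p is the Kaehler form of the
   p-th isotypic component C^(r_p), and the Z_p span z.  An element A of H
   satisfies J_(A Z) = A J_Z A^-1.  As J_Z^2 is the scalar -<Z_p, Z>^2 on the
   p-th component, A sends Z_p to some +-Z_q and the p-th component onto the
   q-th one; hence H acts on the Z_p by signed permutations, each of which lifts
   to H.  The kernel H0 of this action preserves the components and commutes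
   with their complex structures, so it is the product of the unitary groups
   U(r_p).  By the spectral theorem every element of H0, and every
   skew-Hermitian tangent vector, lies on a one-parameter group
   w^* exp(i t theta) w; this gives the connectedness of H0 and its Lie algebra,
   which is also that of H because the +-Z_p form a finite set. *)
Require Import Defs.
From HB Require Import structures.
From mathcomp Require Import all_boot all_order all_algebra all_fingroup.
From mathcomp Require Import complex.
From mathcomp Require Import all_classical all_reals all_analysis.
From mathcomp Require Import ring lra.
Import Order.TTheory GRing.Theory Num.Theory.
Import numFieldNormedType.Exports.
Import complex.ComplexField.
Set Implicit Arguments.
Unset Strict Implicit.
Unset Printing Implicit Defensive.
Local Open Scope classical_set_scope.
Local Open Scope ring_scope.
Local Open Scope complex_scope.
Local Notation "M ^t*" := (map_mx Num.conj (trmx M)) (at level 30).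

(** The vectors [Zw p] span the center but may be linearly dependent, and this shapes the argument.
    A signed permutation of them need not extend to a linear map of the center, let alone to an
    isometry. A lift is therefore built from an element of H whose action on the center is kept,
    never from a permutation alone. For the same reason brackets are tested against one isotypic
    component at a time, where a single [Zw p] survives. The Lie group contributes its bracket at
    the identity, skew by antisymmetrisation and linear by second-order smoothness of the
    multiplication. The isotypic decomposition then yields the facts on which the study of H rests:
    the formula for the bracket, and that the [Zw p] span the vectors without coordinates, are
    nonzero and are pairwise distinct up to sign. The inner product is real while the blocks of H0
    are complex. On each component the real part of the Hermitian form of the coordinates is the
    inner product and its imaginary part is omega_p, so a unitary block preserves both at once. *)

(** * Linearity of the Lie bracket *)

Lemma mixed_diff_skew_linear (R : realType) (V W : normedModType R)
    (mu : V * V -> W) (e : V * V) (a : R) (u u' v : V) :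
  (forall w, differentiable (fun q => 'd mu q w) e) ->
  let D x y := 'd (fun q => 'd mu q (0, y)) e (x, 0) : W in
  D (a *: u + u') v - D v (a *: u + u') =
  a *: (D u v - D v u) + (D u' v - D v u').
Proof.
move=> diff_mu D.
have Dl : D (a *: u + u') v = a *: D u v + D u' v.
  rewrite /D -linearP; congr ('d _ e _).
  by apply: injective_projections; rewrite /= ?scaler0 ?addr0.
(* In this slot the direction sits inside the map that is differentiated, so additivity at [e] rests
   on the differentiability of both summands. *)
have Dr : D v (a *: u + u') = a *: D v u + D v u'.
  have -> : D v (a *: u + u') = 'd (a *: (fun q => 'd mu q (0, u)) +
      (fun q => 'd mu q (0, u'))) e (v, 0).
    rewrite /D; congr ('d _ e _); apply/funext => q /=.
    rewrite !fctE -linearP; congr ('d mu q _).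
    by apply: injective_projections; rewrite /= ?scaler0 ?addr0.
  by rewrite diffD ?diffZ//; exact: differentiableZ.
by move: Dl Dr; clearbody D => -> ->; rewrite scalerBr opprD addrACA.
Qed.

Section LieBracket.
Variables (R : realType) (n : nat) (N : lie_group R n).

Lemma lie_bracketC u v : lie_bracket N u v = - lie_bracket N v u.
Proof. by rewrite /lie_bracket opprB. Qed.

(** Smoothness of order 2 of the multiplication at (e, e), read in the chart, is the
    differentiability that [mixed_diff_skew_linear] asks for. *)
Lemma lie_bracket_linear a u u' v :
  lie_bracket N (a *: u + u') v = a *: lie_bracket N u v + lie_bracket N u' v.
Proof.
apply: mixed_diff_skew_linear => w.
have N_chart := lg_chart_atlas N.
have [_ /(_ _ _ _ N_chart N_chart N_chart 2%N)] := lg_mul_smooth N.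
case=> _ /(_ w) [+ _]; apply.
exists (lg_one N), (lg_one N).
by rewrite lg_mul1g; split=> //; exact: lg_chart_one.
Qed.

End LieBracket.

(** * Matrices of linear maps *)

Section LinearMx.
Variables (R : realType) (m n : nat).

(** Endomorphisms are constructed below as functions, whereas H consists of matrices. The matrix
    represents [f] only when [f] is linear. *)
Definition linfun_mx (f : 'cV[R]_n -> 'cV[R]_m) : 'M[R]_(m, n) :=
  \matrix_(i, j) f (delta_mx j 0) i 0.

Lemma linfun_mxE (f : 'cV[R]_n -> 'cV[R]_m) :
  linear f -> forall x, linfun_mx f *m x = f x.
Proof.
move=> f_lin x; pose fL : {linear 'cV[R]_n -> 'cV[R]_m} :=
  HB.pack f (GRing.isLinear.Build _ _ _ _ f f_lin).
rewrite -[f x]/(fL x) [in RHS](matrix_sum_delta x) linear_sum.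
apply/colP => i; rewrite mxE summxE; apply: eq_bigr => j _.
by rewrite big_ord1 linearZ !mxE mulrC.
Qed.

Lemma col_mx_inj (A B : 'M[R]_(m, n)) :
  (forall x : 'cV[R]_n, A *m x = B *m x) -> A = B.
Proof.
by move=> AB; apply/row_matrixP => i; apply/rowP => j;
  rewrite !mxE; have := congr1 (fun v : 'cV_m => v i 0) (AB (delta_mx j 0));
  rewrite -!colE !mxE.
Qed.

End LinearMx.

(** * Inner products *)

Section InnerProduct.
Variables (R : realType) (n : nat) (ip : 'cV[R]_n -> 'cV[R]_n -> R).
Hypothesis ip_inner : inner_product ip.
Implicit Types (x y z : 'cV[R]_n) (a : R).

Lemma ipC x y : ip x y = ip y x. Proof. by case: ip_inner. Qed.

Lemma ipPl a x y z : ip (a *: x + y) z = a * ip x z + ip y z.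
Proof. by case: ip_inner. Qed.

Lemma ipDl x y z : ip (x + y) z = ip x z + ip y z.
Proof. by have := ipPl 1 x y z; rewrite scale1r mul1r. Qed.

Lemma ip0l z : ip 0 z = 0.
Proof. by apply: (addrI (ip 0 z)); rewrite -ipDl !addr0. Qed.

Lemma ipZl a x z : ip (a *: x) z = a * ip x z.
Proof. by rewrite -[a *: x]addr0 ipPl ip0l addr0. Qed.

Lemma ipNl x z : ip (- x) z = - ip x z.
Proof. by rewrite -scaleN1r ipZl mulN1r. Qed.

Lemma ipBl x y z : ip (x - y) z = ip x z - ip y z.
Proof. by rewrite ipDl ipNl. Qed.

Lemma ip_suml I (r : seq I) (P : pred I) (F : I -> 'cV[R]_n) z :
  ip (\sum_(i <- r | P i) F i) z = \sum_(i <- r | P i) ip (F i) z.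
Proof. by apply: (big_morph (ip^~ z)) => [x y|]; rewrite ?ipDl ?ip0l. Qed.

Lemma ipPr a x y z : ip z (a *: x + y) = a * ip z x + ip z y.
Proof. by rewrite ipC ipPl !(ipC z). Qed.

Lemma ipDr x y z : ip z (x + y) = ip z x + ip z y.
Proof. by rewrite ipC ipDl !(ipC z). Qed.

Lemma ip0r z : ip z 0 = 0. Proof. by rewrite ipC ip0l. Qed.

Lemma ipZr a x z : ip z (a *: x) = a * ip z x.
Proof. by rewrite ipC ipZl (ipC z). Qed.

Lemma ipNr x z : ip z (- x) = - ip z x.
Proof. by rewrite ipC ipNl (ipC z). Qed.

Lemma ipBr x y z : ip z (x - y) = ip z x - ip z y.
Proof. by rewrite ipDr ipNr. Qed.

Lemma ip_sumr I (r : seq I) (P : pred I) (F : I -> 'cV[R]_n) z :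
  ip z (\sum_(i <- r | P i) F i) = \sum_(i <- r | P i) ip z (F i).
Proof. by rewrite ipC ip_suml; apply: eq_bigr => i _; rewrite ipC. Qed.

Lemma ip_eq0 x : (ip x x == 0) = (x == 0).
Proof.
have [->|x0] := eqVneq x 0; first by rewrite ip0l eqxx.
by case: ip_inner => _ _ /(_ _ x0) /gt_eqF.
Qed.

Lemma ip_ge0 x : 0 <= ip x x.
Proof.
have [->|x0] := eqVneq x 0; first by rewrite ip0l.
by case: ip_inner => _ _ /(_ _ x0) /ltW.
Qed.

Lemma ip_nondegenerate x y : (forall z, ip x z = ip y z) -> x = y.
Proof.
move=> xy; apply/eqP; rewrite -subr_eq0 -ip_eq0.
by rewrite ipBl xy subrr.
Qed.

Lemma cauchy_schwarz x y : ip x y ^+ 2 <= ip x x * ip y y.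
Proof.
have [->|y0] := eqVneq y 0; first by rewrite !ip0r expr0n mulr0.
have yy : 0 < ip y y by case: ip_inner => _ _ /(_ _ y0).
have := ip_ge0 (ip y y *: x - ip x y *: y).
rewrite ipBl !ipBr !ipZl !ipZr (ipC y x).
rewrite [X in 0 <= X -> _](_ : _ =
  ip y y * (ip x x * ip y y - ip x y ^+ 2)); last by ring.
by rewrite pmulr_rge0// subr_ge0.
Qed.

(** A space is not the union of two proper hyperplanes: with u = x - y and v = x + y, the product of
    <u, z> and <v, z> vanishes on [S]. Taking z = u gives u = 0 or v orthogonal to u, and in the
    latter case z = u + v forces u = 0 or v = 0. *)
Lemma eq_or_opp_of_ip_sqr x y (S : set 'cV[R]_n) :
  (forall a u v, S u -> S v -> S (a *: u + v)) -> S x -> S y ->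
  (forall z, S z -> ip x z ^+ 2 = ip y z ^+ 2) -> x = y \/ x = - y.
Proof.
move=> S_lin Sx Sy xy; set u := x - y; set v := x + y.
have Su : S u by rewrite /u addrC -scaleN1r; exact: S_lin.
have Sv : S v by rewrite /v -[x]scale1r; exact: S_lin.
have uv z : S z -> ip u z * ip v z = 0.
  by move=> /xy; rewrite ipBl ipDl -subr_sqr => ->; rewrite subrr.
have u_eq0 : u = 0 -> x = y by move/eqP; rewrite subr_eq0 => /eqP.
have v_eq0 : v = 0 -> x = - y by move/eqP; rewrite addr_eq0 => /eqP.
clearbody u v; have [/u_eq0|u0] := eqVneq u 0; first by left.
have vu : ip v u = 0.
  by have /eqP := uv _ Su; rewrite mulf_eq0 ip_eq0 (negbTE u0) => /eqP.
right; apply: v_eq0; apply/eqP; rewrite -ip_eq0.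
have /eqP := uv (1 *: u + v) (S_lin _ _ _ Su Sv).
rewrite scale1r !ipDr vu (ipC u v) vu addr0 add0r mulf_eq0 !ip_eq0.
by rewrite (negbTE u0).
Qed.

(** Gram-Schmidt, one vector of [s] at a time. The last clause stands for [w] being in the span of
    [s]; it is carried for the induction. *)
Lemma orthogonal_projection_exists (S : set 'cV[R]_n) (s : seq 'cV[R]_n) :
  S 0 -> (forall a u v, S u -> S v -> S (a *: u + v)) ->
  (forall v, v \in s -> S v) ->
  forall x, exists w, [/\ S w, (forall v, v \in s -> ip (x - w) v = 0) &
    forall y, (forall v, v \in s -> ip y v = 0) -> ip y w = 0].
Proof.
move=> S0 S_lin; elim: s => [|v s IH] Ss x.
  by exists 0; split=> // y _; rewrite ip0r.
have {}IH := IH (fun u us => Ss u (mem_behead (s := v :: s) us)).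
have [w [Sw xw w_perp]] := IH x; have [u [Su vu u_perp]] := IH v.
have Svu : S (v - u).
  by rewrite addrC -scaleN1r; apply: S_lin => //; exact/Ss/mem_head.
(* Coefficient of x - w along v - u, the part of [v] orthogonal to the earlier vectors. If v - u =
   0, the quotient is 0 by convention and the term vanishes anyway. *)
pose c := ip (x - w) (v - u) / ip (v - u) (v - u).
exists (c *: (v - u) + w); split=> [|z|y y_perp].
- exact: S_lin.
- have xcw : x - (c *: (v - u) + w) = (x - w) - c *: (v - u).
    by rewrite opprD addrCA addrC.
  rewrite xcw ipBl ipZl inE => /predU1P[->|zs]; last first.
    by rewrite xw// vu// mulr0 subrr.
  have ip_v y : (forall v, v \in s -> ip y v = 0) -> ip y v = ip y (v - u).
    by move=> ys; rewrite ipBr u_perp// subr0.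
  rewrite (ip_v _ xw) (ip_v _ vu) /c.
  have [->|vu0] := eqVneq (v - u) 0; first by rewrite !ip0r mulr0 subrr.
  by rewrite divfK ?subrr// ip_eq0.
- have ys : forall z, z \in s -> ip y z = 0.
    by move=> z zs; rewrite y_perp// inE zs orbT.
  rewrite ipPr ipBr y_perp ?mem_head// (u_perp _ ys) (w_perp _ ys).
  by rewrite subrr mulr0 addr0.
Qed.

End InnerProduct.

(** * Complex coordinates on the isotypic components *)

Section ComplexParts.
Variable R : realType.
Implicit Types (a : R) (z w : R[i]).

Lemma complex_eq z w :
  complex.Re z = complex.Re w -> complex.Im z = complex.Im w -> z = w.
Proof. by case: z w => a b [c d] /= -> ->. Qed.

Lemma ReD z w : complex.Re (z + w) = complex.Re z + complex.Re w.
Proof. by case: z w => a b []. Qed.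

Lemma ImD z w : complex.Im (z + w) = complex.Im z + complex.Im w.
Proof. by case: z w => a b []. Qed.

Lemma ReN z : complex.Re (- z) = - complex.Re z. Proof. by case: z. Qed.

Lemma ImN z : complex.Im (- z) = - complex.Im z. Proof. by case: z. Qed.

Lemma ReM z w : complex.Re (z * w) =
  complex.Re z * complex.Re w - complex.Im z * complex.Im w.
Proof. by case: z w => a b []. Qed.

Lemma ImM z w : complex.Im (z * w) =
  complex.Re z * complex.Im w + complex.Im z * complex.Re w.
Proof. by case: z w => a b []. Qed.

Lemma Re_conj z : complex.Re z^* = complex.Re z. Proof. by case: z. Qed.

Lemma Im_conj z : complex.Im z^* = - complex.Im z. Proof. by case: z. Qed.

Lemma Re_sum I (s : seq I) (P : pred I) (F : I -> R[i]) :
  complex.Re (\sum_(i <- s | P i) F i) = \sum_(i <- s | P i) complex.Re (F i).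
Proof. by apply: (big_morph (@complex.Re R)) => // z w; exact: ReD. Qed.

Lemma Im_sum I (s : seq I) (P : pred I) (F : I -> R[i]) :
  complex.Im (\sum_(i <- s | P i) F i) = \sum_(i <- s | P i) complex.Im (F i).
Proof. by apply: (big_morph (@complex.Im R)) => // z w; exact: ImD. Qed.

(** The real inner product sees only the real part of a Hermitian form. Nothing is lost, since
    testing on d and on i d recovers both parts of each entry. *)
Lemma mx_eq0_of_Re_form m (M : 'M[R[i]]_m) :
  (forall w w' : 'cV[R[i]]_m, complex.Re ((w^t* *m M *m w') 0 0) = 0) -> M = 0.
Proof.
move=> M0; apply/matrixP => i j; rewrite mxE.
have form (c d : R[i]) : complex.Re (c^* * M i j * d) = 0.
  have := M0 (c *: delta_mx i 0) (d *: delta_mx j 0).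
  rewrite -scalemxAr mxE [in X in _ * X]mxE.
  rewrite (bigD1 j)//= big1 ?addr0 => [|k /negbTE kj]; last first.
    by rewrite [X in _ * X]mxE kj mulr0.
  rewrite [X in _ * (_ * X)]mxE !eqxx mulr1 mxE.
  rewrite (bigD1 i)//= big1 ?addr0 => [|k /negbTE ki]; last first.
    by rewrite !mxE ki /= mulr0 conjC0 mul0r.
  by rewrite !mxE !eqxx mulr1 mulrC.
apply: complex_eq; first by have := form 1 1; rewrite conjC1 mul1r mulr1.
have := form 1 'i; rewrite conjC1 mul1r ReM/= mulr0 mulr1 sub0r.
by move/eqP; rewrite oppr_eq0 => /eqP.
Qed.

End ComplexParts.

Section Coordinates.
Variables (R : realType) (n : nat) (ip : 'cV[R]_n -> 'cV[R]_n -> R).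
Hypothesis ip_inner : inner_product ip.
Variables (k : nat) (r : 'I_k -> nat).
Variables (X Y : forall p : 'I_k, 'I_(r p) -> 'cV[R]_n).
Arguments X : clear implicits.
Arguments Y : clear implicits.
Hypothesis XY_orthonormal : forall p (i : 'I_(r p)) q (j : 'I_(r q)),
  let delta : R := ((p == q) && (i == j :> nat))%:R in
  [/\ ip (X p i) (X q j) = delta, ip (Y p i) (Y q j) = delta &
      ip (X p i) (Y q j) = 0].
Implicit Types (x y z : 'cV[R]_n) (a : R) (p q : 'I_k).

Local Notation fromC := (from_complex X Y).

Definition coords p x : 'cV[R[i]]_(r p) :=
  \col_i (ip x (X p i) +i* ip x (Y p i)).

Lemma coordsP p a x y : coords p (a *: x + y) = a%:C *: coords p x + coords p y.
Proof.
apply/colP => i; rewrite !mxE !(ipPl ip_inner).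
by apply: complex_eq; rewrite /= mul0r ?subr0 ?addr0.
Qed.

Lemma coordsD p x y : coords p (x + y) = coords p x + coords p y.
Proof. by have := coordsP p 1 x y; rewrite !scale1r. Qed.

Lemma coords0 p : coords p 0 = 0.
Proof. by apply: (addrI (coords p 0)); rewrite -coordsD !addr0. Qed.

Lemma coordsZ p a x : coords p (a *: x) = a%:C *: coords p x.
Proof. by rewrite -[a *: x]addr0 coordsP coords0 addr0. Qed.

Lemma coordsN p x : coords p (- x) = - coords p x.
Proof. by rewrite -scaleN1r coordsZ rmorphN scaleN1r. Qed.

Lemma coords_sum p I (s : seq I) (P : pred I) (F : I -> 'cV[R]_n) :
  coords p (\sum_(i <- s | P i) F i) = \sum_(i <- s | P i) coords p (F i).
Proof. by apply: (big_morph (coords p)) => [x y|]; rewrite ?coordsD ?coords0. Qed.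

Lemma fromCP p a (w w' : 'cV[R[i]]_(r p)) :
  fromC (a%:C *: w + w') = a *: fromC w + fromC w'.
Proof.
rewrite /from_complex scaler_sumr -big_split; apply: eq_bigr => i _ /=.
rewrite !mxE ReD ImD ReM ImM /= !mul0r subr0 addr0.
by rewrite !scalerDl scalerDr !scalerA addrACA.
Qed.

Lemma fromCD p (w w' : 'cV[R[i]]_(r p)) : fromC (w + w') = fromC w + fromC w'.
Proof. by have := fromCP 1 w w'; rewrite !scale1r. Qed.

Lemma fromC0 p : fromC (0 : 'cV[R[i]]_(r p)) = 0.
Proof. by apply: (addrI (fromC (p := p) 0)); rewrite -fromCD !addr0. Qed.

Lemma fromCZ p a (w : 'cV[R[i]]_(r p)) : fromC (a%:C *: w) = a *: fromC w.
Proof. by rewrite -[a%:C *: w]addr0 fromCP fromC0 addr0. Qed.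

Lemma fromC_sum p I (s : seq I) (P : pred I) (F : I -> 'cV[R[i]]_(r p)) :
  fromC (\sum_(i <- s | P i) F i) = \sum_(i <- s | P i) fromC (F i).
Proof.
by apply: (big_morph (fun w => fromC w)) => [w w'|]; rewrite ?fromCD ?fromC0.
Qed.

Lemma fromC_delta p j : fromC (delta_mx j 0 : 'cV[R[i]]_(r p)) = X p j.
Proof.
rewrite /from_complex (bigD1 j)//= big1 ?addr0 => [|i /negbTE ij].
  by rewrite mxE !eqxx scale1r scale0r addr0.
by rewrite mxE ij !scale0r addr0.
Qed.

Lemma fromC_idelta p j : fromC ('i *: delta_mx j 0 : 'cV[R[i]]_(r p)) = Y p j.
Proof.
rewrite /from_complex (bigD1 j)//= big1 ?addr0 => [|i /negbTE ij].
  by rewrite !mxE !eqxx mulr1 scale1r scale0r add0r.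
by rewrite !mxE ij mulr0 !scale0r addr0.
Qed.

Lemma ip_fromC p (w : 'cV[R[i]]_(r p)) x :
  ip (fromC w) x = complex.Re ((w^t* *m coords p x) 0 0).
Proof.
rewrite /from_complex ip_suml // mxE Re_sum; apply: eq_bigr => i _.
rewrite ipDl// !ipZl// !mxE ReM Re_conj Im_conj /= mulNr opprK.
by rewrite (ipC _ x) // (ipC _ x).
Qed.

Lemma coords_fromC p (w : 'cV[R[i]]_(r p)) : coords p (fromC w) = w.
Proof.
have deltaE (i j : 'I_(r p)) : ((p == p) && (i == j :> nat)) = (i == j).
  by rewrite eqxx.
apply/colP => i; rewrite mxE /from_complex !ip_suml//.
apply: complex_eq => /=; rewrite (bigD1 i)//= [X in _ + X]big1 => [|j /negbTE ji].
- rewrite ipDl// !ipZl// [ip (Y p _) (X p _)]ipC//.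
  have [-> _ ->] := XY_orthonormal i i.
  by rewrite !eqxx mulr0 mulr1 !addr0.
- rewrite ipDl// !ipZl// [ip (Y p _) (X p _)]ipC//.
  have [-> _ _] := XY_orthonormal j i; have [_ _ ->] := XY_orthonormal i j.
  by rewrite deltaE ji !mulr0 addr0.
- rewrite ipDl// !ipZl//; have [_ -> ->] := XY_orthonormal i i.
  by rewrite !eqxx mulr0 mulr1 add0r addr0.
- rewrite ipDl// !ipZl//; have [_ -> ->] := XY_orthonormal j i.
  by rewrite deltaE ji !mulr0 addr0.
Qed.

Lemma coords_fromC_neq p q (w : 'cV[R[i]]_(r p)) :
  p != q -> coords q (fromC w) = 0.
Proof.
move=> /negbTE pq; apply/colP => i; rewrite !mxE /from_complex !ip_suml//.
apply: complex_eq => /=; apply: big1 => j _; rewrite ipDl// !ipZl//.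
  rewrite [ip (Y p _) (X q _)]ipC//.
  have [-> _ _] := XY_orthonormal j i; have [_ _ ->] := XY_orthonormal i j.
  by rewrite pq !mulr0 addr0.
have [_ -> ->] := XY_orthonormal j i.
by rewrite pq !mulr0 addr0.
Qed.

Lemma coords_sum_fromC q (w : forall p, 'cV[R[i]]_(r p)) :
  coords q (\sum_p fromC (w p)) = w q.
Proof.
rewrite coords_sum (bigD1 q)//= coords_fromC big1 ?addr0// => p pq.
exact: coords_fromC_neq.
Qed.

(** The part of [x] orthogonal to all isotypic components; its range will be identified with the
    center. *)
Definition zpart x := x - \sum_p fromC (coords p x).

Lemma zpartK x : x = zpart x + \sum_p fromC (coords p x).
Proof. by rewrite subrK. Qed.

Lemma coords_zpart p x : coords p (zpart x) = 0.
Proof. by rewrite coordsD coordsN coords_sum_fromC subrr. Qed.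

Lemma zpart_id z : (forall p, coords p z = 0) -> zpart z = z.
Proof. by move=> z0; rewrite /zpart big1 ?subr0// => p _; rewrite z0 fromC0. Qed.

Lemma zpart_linear : linear zpart.
Proof.
move=> a x y; rewrite /zpart scalerBr addrACA -opprD; congr (_ - _).
rewrite scaler_sumr -big_split; apply: eq_bigr => p _ /=.
by rewrite coordsP fromCP.
Qed.

Lemma ip_fromC_perp p (w : 'cV[R[i]]_(r p)) z :
  coords p z = 0 -> ip (fromC w) z = 0.
Proof. by move=> z0; rewrite ip_fromC z0 mulmx0 mxE. Qed.

Lemma ip_coords x y : ip x y = ip (zpart x) (zpart y) +
  \sum_p complex.Re (((coords p x)^t* *m coords p y) 0 0).
Proof.
rewrite {1}(zpartK x) ipDl// ip_suml//; congr (_ + _); last first.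
  by apply: eq_bigr => p _; rewrite ip_fromC.
rewrite {1}(zpartK y) ipDr// ip_sumr// [X in _ + X]big1 ?addr0// => p _.
by rewrite ipC// ip_fromC_perp// coords_zpart.
Qed.

Definition omega p x y : R := complex.Im (((coords p x)^t* *m coords p y) 0 0).

Lemma omegaE p x y : omega p x y =
  \sum_i (ip x (X p i) * ip y (Y p i) - ip x (Y p i) * ip y (X p i)).
Proof.
rewrite /omega mxE Im_sum; apply: eq_bigr => i _.
by rewrite !mxE ImM Re_conj Im_conj mulNr.
Qed.

(** The Kaehler form is the metric twisted by the complex structure. This is what converts the
    bracket into the J-map. *)
Lemma omega_ip p x y : omega p x y = ip (fromC ('i *: coords p x)) y.
Proof.
rewrite ip_fromC [in RHS]mxE Re_sum /omega mxE Im_sum; apply: eq_bigr => i _.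
have -> : ('i *: coords p x)^t* 0 i = ('i * coords p x i 0)^* by rewrite !mxE.
have -> : (coords p x)^t* 0 i = (coords p x i 0)^* by rewrite !mxE.
by case: (coords p x i 0) (coords p y i 0) => a b [c d] /=; ring.
Qed.

(** Replaces induction over a basis: the vectors without coordinates, later the center, are treated
    all at once because no basis of them is at hand. *)
Lemma vec_ind (P : 'cV[R]_n -> Prop) :
  (forall a x y, P x -> P y -> P (a *: x + y)) ->
  (forall z, (forall p, coords p z = 0) -> P z) ->
  (forall p i, P (X p i)) -> (forall p i, P (Y p i)) -> forall x, P x.
Proof.
move=> P_lin Pz PX PY x; have P0 : P 0 by apply: Pz => p; exact: coords0.
have PD u v : P u -> P v -> P (u + v).
  by move=> Pu Pv; rewrite -[u]scale1r; exact: P_lin.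
have PZ a u : P u -> P (a *: u).
  by move=> Pu; rewrite -[a *: u]addr0; exact: P_lin.
rewrite (zpartK x); apply: (PD); first by apply: Pz => p; exact: coords_zpart.
apply: (big_ind P) => // p _; rewrite /from_complex; apply: (big_ind P) => // i _.
by apply: (PD); exact: PZ.
Qed.

End Coordinates.

(** * Convergence of matrices and derivatives of curves *)

Section MatrixTopology.

Lemma cvg_mx (S : Type) (F : set_system S) (U : topologicalType) (m n : nat)
    (f : S -> 'M[U]_(m, n)) (M : 'M[U]_(m, n)) :
  Filter F -> (forall i j, f t i j @[t --> F] --> M i j) -> f @ F --> M.
Proof.
move=> FF fM A [P PM PA]; change (F (f @^-1` A)).
apply: (@filterS _ F _ (fun t => forall i j, P i j (f t i j))) => [t|].
  exact: PA.
apply: filter_forall => i; apply: filter_forall => j.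
exact: fM (PM i j).
Qed.

Lemma mx_entry_continuous (U : topologicalType) (m n : nat) (i : 'I_m) (j : 'I_n) :
  continuous (fun M : 'M[U]_(m, n) => M i j).
Proof.
(* The box constrains the entry (i, j) alone; its other factors are the whole space. *)
move=> M A MA; exists (fun k l => [set x | k = i -> l = j -> A x]) => [k l|N NA].
  have [[-> ->]|kl] := pselect (k = i /\ l = j); first by apply: filterS MA => x Ax.
  by apply: filterS filterT => x _ ki lj; case: kl.
exact: NA.
Qed.

Lemma cvg_prod_topology (S : Type) (F : set_system S) (I : eqType)
    (K : I -> topologicalType) (f : S -> prod_topology K) (g : prod_topology K) :
  Filter F -> (forall i, f t i @[t --> F] --> g i) -> f @ F --> g.
Proof.
move=> FF fg; apply/cvg_sup => i A [_ [[B B_open <-] Bg BA]].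
change (F (f @^-1` A)); apply: (@filterS _ F _ (fun t => B (f t i))) => [t|].
  exact: BA.
by apply: fg; exact: open_nbhs_nbhs.
Qed.

Lemma cvg_sumr (R : numFieldType) (W : normedModType R) (S : Type)
    (F : set_system S) (I : Type) (s : seq I) (f : I -> S -> W) (a : I -> W) :
  Filter F -> (forall i, f i x @[x --> F] --> a i) ->
  \sum_(i <- s) f i x @[x --> F] --> \sum_(i <- s) a i.
Proof. by move=> FF fa; apply: cvg_big => [|i _ //]; exact: add_continuous. Qed.

Lemma linear_mx_continuous (R : realType) (m n : nat) (W : normedModType R)
    (f : 'M[R]_(m, n) -> W) : linear f -> continuous f.
Proof.
move=> f_lin; pose fL : {linear 'M[R]_(m, n) -> W} :=
  HB.pack f (GRing.isLinear.Build _ _ _ _ f f_lin).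
have -> : f = fun M => \sum_i \sum_j M i j *: fL (delta_mx i j).
  apply/funext => M; rewrite -[f M]/(fL M) {1}(matrix_sum_delta M) linear_sum.
  apply: eq_bigr => i _; rewrite linear_sum; apply: eq_bigr => j _.
  exact: linearZ.
move=> M; have nM : Filter (nbhs M) by exact: nbhs_filter.
apply: (@cvg_sumr _ _ _ (nbhs M)) => i; apply: (@cvg_sumr _ _ _ (nbhs M)) => j.
by apply: cvgZr_tmp; exact: coord_continuous.
Qed.

(** Heine-Borel for row vectors, transported by the continuous reshaping [vec_mx]. *)
Lemma bounded_closed_compact_mx (R : realType) (m n : nat) (A : set 'M[R]_(m, n))
    (C : 'I_m -> 'I_n -> R) :
  closed A -> (forall M, A M -> forall i j, `|M i j| <= C i j) -> compact A.
Proof.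
move=> A_closed A_bounded.
have vec_cont : continuous (@vec_mx R m n).
  by apply: linear_mx_continuous => a u v; rewrite linearP.
have -> : A = vec_mx @` (vec_mx @^-1` A).
  apply/seteqP; split=> [M AM|_ [v Av <-]//].
  by exists (mxvec M); rewrite /= mxvecK.
apply: continuous_compact.
  by apply: continuous_subspaceT => x; exact: vec_cont.
apply: bounded_closed_compact; last exact: closed_comp.
pose D := \sum_i \sum_j `|C i j|; have D_ge0 : 0 <= D.
  by apply: sumr_ge0 => i _; apply: sumr_ge0.
exists D; split=> [|E DE v Av]; first exact: num_real.
rewrite /Num.norm/= mx_normrE (bigmax_le _ (le_trans D_ge0 (ltW DE)))//.
move=> [i j] _ /=; rewrite (ord1 i) -[v]vec_mxK; case/mxvec_indexP: j => a b.
rewrite mxvecE (le_trans (A_bounded _ Av _ _))// (le_trans (ler_norm _))//.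
apply: le_trans (ltW DE); rewrite /D (bigD1 a)//= (bigD1 b)//= -addrA lerDl.
by rewrite addr_ge0// sumr_ge0// => i' _; rewrite sumr_ge0.
Qed.

End MatrixTopology.

Lemma is_deriveP (R : realType) (W : normedModType R) (f : R -> W) (x : R)
    (df : W) :
  is_derive x 1 f df <-> h^-1 *: (f (h + x) - f x) @[h --> 0^'] --> df.
Proof.
have E : (fun h : R => h^-1 *: (f (h + x) - f x)) =
    (fun h => h^-1 *: ((f \o shift x) (h *: (1 : R)) - f x)).
  by apply/funext => h /=; rewrite [h *: _]mulr1.
rewrite E; split=> [[fx <-]|fx]; first exact: fx.
split; first by apply/cvg_ex; exists df.
exact/cvg_lim.
Qed.

Lemma is_derive_scale_cst (R : realType) (W : normedModType R) (f : R -> R)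
    (x df : R) (B : W) :
  is_derive x 1 f df -> is_derive x 1 (fun t => f t *: B) (df *: B).
Proof.
move=> [f_drv <-]; apply/is_deriveP.
have -> : (fun h : R => h^-1 *: (f (h + x) *: B - f x *: B)) =
    (fun h => (h^-1 *: (f (h + x) - f x)) *: B).
  by apply/funext => h; rewrite -scalerBl scalerA.
by apply: cvgZr_tmp; apply/is_deriveP; split.
Qed.

Lemma is_derive_bigsum (R : realType) (W : normedModType R) (I : Type)
    (s : seq I) (f : I -> R -> W) (x : R) (df : I -> W) : (forall i, is_derive x 1 (f i) (df i)) ->
  is_derive x 1 (fun t => \sum_(i <- s) f i t) (\sum_(i <- s) df i).
Proof.
move=> fdf; elim: s => [|i s IH].
  rewrite big_nil; under eq_fun do rewrite big_nil; exact: is_derive_cst.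
by rewrite big_cons; under eq_fun do rewrite big_cons; exact: is_deriveD.
Qed.

Lemma is_derive_trig (R : realType) (W : normedModType R) (B C : W)
    (theta x : R) :
  is_derive x 1 (fun t => cos (t * theta) *: B + sin (t * theta) *: C)
    ((- sin (x * theta) * theta) *: B + (cos (x * theta) * theta) *: C).
Proof.
have d_mul : is_derive x 1 (fun t : R => t * theta) theta.
  by have := is_derive_scale_cst (W := R^o) theta (is_derive_id x 1);
    rewrite [1 *: _]mul1r.
by apply: is_deriveD; apply: is_derive_scale_cst.
Qed.

Lemma is_derive_continuous (R : realType) (W : normedModType R) (f : R -> W)
    (x : R) (df : W) :
  is_derive x 1 f df -> {for x, continuous f}.
Proof.
by move=> [/derivable1_diffP/differentiable_continuous].
Qed.

Section ComplexTopology.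
Variable R : realType.

Lemma complex_part_continuous (f : R[i]^o -> R) :
  (forall z w, f (z - w) = f z - f w) -> (forall z, `|f z|%:C <= `|z|) ->
  continuous f.
Proof.
move=> fB f_le z; apply/(@cvgrPdist_lt _ _ _ (nbhs z) (nbhs_filter z)) => e e0.
have e0C : 0 < e%:C by rewrite ltcR.
apply: (@filterS _ (nbhs z) (nbhs_filter z) (fun w => `|z - w| < e%:C)).
  by move=> w; rewrite -fB -ltcR; exact: le_lt_trans.
exact: (@cvgr_dist_lt _ _ _ (nbhs z) (nbhs_filter z) id z).
Qed.

Lemma Re_continuous : continuous (fun z : R[i]^o => complex.Re z).
Proof.
apply: complex_part_continuous => [z w|]; first by rewrite ReD ReN.
exact: normc_ge_Re.
Qed.

Lemma Im_continuous : continuous (fun z : R[i]^o => complex.Im z).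
Proof.
apply: complex_part_continuous => [[a b] [c d] //|[a b]] /=.
rewrite normc_def /= lecR -sqrtr_sqr ler_wsqrtr// lerDr; exact: sqr_ge0.
Qed.

Lemma cvg_complex (S : Type) (F : set_system S) (f : S -> R[i]^o) (z : R[i]^o) :
  Filter F -> complex.Re (f t) @[t --> F] --> complex.Re z ->
  complex.Im (f t) @[t --> F] --> complex.Im z -> f @ F --> z.
Proof.
(* In the partial order of [R[i]] a positive [e] is real, so it can be halved through its real
   part. *)
move=> FF fRe fIm; apply/cvgrPdist_lt => e; rewrite ltcE => /andP[/eqP eIm e0].
have e20 : 0 < complex.Re e / 2 by rewrite divr_gt0.
have eE : e = (complex.Re e / 2)%:C + (complex.Re e / 2)%:C.
  by apply: complex_eq; rewrite /= ?addr0// -splitr.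
move/cvgrPdist_lt/(_ _ e20) : fRe; move/cvgrPdist_lt/(_ _ e20) : fIm.
apply: filterS2 => t fIm fRe.
set w := z - f t.
have -> : w = (complex.Re w)%:C + 'i * (complex.Im w)%:C.
  by rewrite {1}[w]complexE.
rewrite eE (le_lt_trans (ler_normD _ _))// ltrD//.
  by rewrite normc_def /= expr0n addr0 sqrtr_sqr ltcR /w ReD ReN.
rewrite normrM [X in X * _](_ : _ = 1) ?mul1r.
  by rewrite normc_def /= expr0n addr0 sqrtr_sqr ltcR /w ImD ImN.
by rewrite normc_def /= expr0n add0r expr1n sqrtr1.
Qed.

End ComplexTopology.

(** * Spectral form of unitary and skew-Hermitian matrices *)

Section SpectralForm.
Variables (C : numClosedFieldType) (m : nat).
Implicit Types (M w : 'M[C]_m) (d : 'I_m -> C).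

Definition spectral_form w (d : 'I_m -> C) : 'M[C]_m :=
  w^t* *m diag_mx (\row_j d j) *m w.

(** For fixed [w] the matrix is linear in [d], with constant rank-one coefficients. A curve of
    eigenvalues is thereby differentiated coefficient by coefficient. *)
Lemma spectral_formE w d :
  spectral_form w d = \sum_j d j *: (w^t* *m delta_mx j j *m w).
Proof.
rewrite /spectral_form diag_mx_sum_delta mulmx_sumr mulmx_suml.
by apply: eq_bigr => j _; rewrite mxE -scalemxAr -scalemxAl.
Qed.

Lemma spectral_form_unitary w d : w \is unitarymx ->
  (forall j, d j * Num.conj (d j) = 1) -> spectral_form w d \is unitarymx.
Proof.
move=> w_unitary d1; apply: mul_unitarymx => //; apply: mul_unitarymx.
  by rewrite trmxC_unitary.
apply/unitarymxP; rewrite tr_diag_mx map_diag_mx mulmx_diag.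
by apply/matrixP => i j; rewrite !mxE; have [->|] := eqVneq i j; rewrite ?d1.
Qed.

Lemma normal_spectral_form M : M \is normalmx ->
  exists w d, w \is unitarymx /\ M = spectral_form w d.
Proof.
move=> /orthomx_spectralP ME.
exists (spectralmx M), (fun j => spectral_diag M 0 j).
split; first exact: spectral_unitarymx.
rewrite {1}ME invmx_unitary ?spectral_unitarymx//; congr (_ *m diag_mx _ *m _).
by apply/rowP => j; rewrite mxE.
Qed.

Lemma spectral_form_diag w d j : w \is unitarymx ->
  (w *m spectral_form w d *m w^t*) j j = d j.
Proof.
move=> /unitarymxP w1; rewrite /spectral_form !mulmxA w1 mul1mx.
by rewrite -mulmxA w1 mulmx1 !mxE eqxx.
Qed.

Lemma trmxC_spectral_form w d :
  (spectral_form w d)^t* = spectral_form w (fun j => Num.conj (d j)).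
Proof.
rewrite /spectral_form !trmx_mul !map_mxM trmxCK tr_diag_mx map_diag_mx mulmxA.
by congr (_ *m diag_mx _ *m _); apply/rowP => j; rewrite !mxE.
Qed.

Lemma spectral_formM w d d' : w \is unitarymx ->
  spectral_form w d *m spectral_form w d' = spectral_form w (fun j => d j * d' j).
Proof.
move=> /unitarymxP w1; rewrite /spectral_form !mulmxA.
rewrite -[_ *m w *m w^t*]mulmxA w1 mulmx1 -[_ *m diag_mx _ *m diag_mx _]mulmxA.
rewrite mulmx_diag; congr (_ *m diag_mx _ *m _).
by apply/rowP => j; rewrite !mxE.
Qed.

End SpectralForm.

Section UnitarySpectrum.
Variable R : realType.

Lemma polar_angle (z : R[i]) : z * z^* = 1 ->
  exists theta : R, z = cos theta +i* sin theta.
Proof.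
case: z => a b /(congr1 (@complex.Re R)) /=.
rewrite mulrN opprK -!expr2 => ab1.
have a1 : -1 <= a <= 1.
  rewrite -ler_norml -(ler_pXn2r (n := 2)) ?nnegrE// expr1n.
  by rewrite real_normK ?num_real// -ab1 lerDl sqr_ge0.
have b2 : b ^+ 2 = sin (acos a) ^+ 2.
  by rewrite sin2cos2 acosK// -ab1 addrAC subrr add0r.
have /orP[/eqP ->|/eqP ->] : (b == sin (acos a)) || (b == - sin (acos a)).
  by rewrite -eqf_sqr b2.
  by exists (acos a); rewrite acosK.
by exists (- acos a); rewrite cosN sinN acosK.
Qed.

Variable m : nat.
Implicit Types M w : 'M[R[i]]_m.

Lemma unitary_spectral M : M \is unitarymx -> exists w theta,
  w \is unitarymx /\ M = spectral_form w (fun j => cos (theta j) +i* sin (theta j)).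
Proof.
move=> M_unitary; have MM := unitarymxP M_unitary.
have [|w [d [w_unitary ME]]] := @normal_spectral_form _ _ M.
  apply/normalmxP; rewrite MM.
  by have := M_unitary; rewrite -trmxC_unitary => /unitarymxP; rewrite trmxCK.
(* The moduli of the eigenvalues are the diagonal of M times its adjoint, conjugated by [w], and
   that product is 1. *)
have d1 j : d j * (d j)^* = 1.
  have := spectral_form_diag (fun j => d j * (d j)^*) j w_unitary.
  rewrite -spectral_formM// -trmxC_spectral_form -ME MM mulmx1.
  by rewrite (unitarymxP w_unitary) mxE eqxx => <-.
have [theta dE] := choice (fun j => polar_angle (d1 j)).
have {}dE : d = fun j => cos (theta j) +i* sin (theta j) by exact/funext.
rewrite dE in ME; exists w, theta; exact: conj w_unitary ME.
Qed.

Lemma skew_spectral M : M^t* = - M -> exists w (theta : 'I_m -> R),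
  w \is unitarymx /\ M = spectral_form w (fun j => 0 +i* theta j).
Proof.
move=> M_skew.
have [|w [d [w_unitary ME]]] := @normal_spectral_form _ _ M.
  by apply/normalmxP; rewrite M_skew mulmxN mulNmx.
have dE : d = fun j => 0 +i* complex.Im (d j).
  apply/funext => j.
  have := spectral_form_diag (fun j => (d j)^*) j w_unitary.
  rewrite -trmxC_spectral_form -ME M_skew mulmxN mulNmx mxE ME spectral_form_diag//.
  case: (d j) => a b /= [] /eqP; rewrite eq_sym -addr_eq0 -mulr2n mulrn_eq0 /=.
  by move=> /eqP ->.
exists w, (fun j => complex.Im (d j)).
exact: conj w_unitary (etrans ME (congr1 (spectral_form w) dE)).
Qed.

End UnitarySpectrum.

(** * Isometric automorphisms *)

Lemma ip_isometry_unitmx (R : realType) (n : nat)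
    (ip : 'cV[R]_n -> 'cV[R]_n -> R) (A : 'M[R]_n) :
  inner_product ip -> (forall x y, ip (A *m x) (A *m y) = ip x y) ->
  A \in unitmx.
Proof.
move=> ip_inner A_iso; rewrite -unitmx_tr -row_free_unit.
apply/row_freeP; apply/row_freeP; rewrite -kermx_eq0; apply/rowV0P => v.
move=> /sub_kermxP vA; apply/eqP; rewrite -trmx_eq0 -(ip_eq0 ip_inner) -A_iso.
by rewrite -[A]trmxK -trmx_mul vA trmx0 (ip0l ip_inner).
Qed.

Section IsotropyGroup.
Variables (R : realType) (n : nat) (br : 'cV[R]_n -> 'cV[R]_n -> 'cV[R]_n).
Variable ip : 'cV[R]_n -> 'cV[R]_n -> R.

Lemma matrix_group_isotropy : matrix_group (isotropy br ip).
Proof.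
split=> [|A B [A_unit A_br A_ip] [B_unit B_br B_ip]|A [A_unit A_br A_ip]].
- by split=> [|x y|x y]; rewrite ?unitmx1 ?mul1mx.
- split=> [|x y|x y]; first by rewrite unitmx_mul A_unit.
    by rewrite -!mulmxA B_br A_br.
  by rewrite -!mulmxA A_ip B_ip.
- split=> //; split=> [|x y|x y]; first by rewrite unitmx_inv.
    by rewrite -{1}(mulKVmx A_unit x) -{1}(mulKVmx A_unit y) -A_br mulKmx.
  by rewrite -A_ip !mulKVmx.
Qed.

Lemma isotropyM A B : isotropy br ip A -> isotropy br ip B ->
  isotropy br ip (A *m B).
Proof. by case: matrix_group_isotropy => _ + _; apply. Qed.

Lemma isotropyV A : isotropy br ip A -> isotropy br ip (invmx A).
Proof. by case: matrix_group_isotropy => _ _ /[apply] -[]. Qed.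

Lemma isotropy_unit A : isotropy br ip A -> A \in unitmx.
Proof. by case. Qed.

Lemma isotropyK A (x : 'cV[R]_n) : isotropy br ip A -> invmx A *m (A *m x) = x.
Proof. by move=> /isotropy_unit A_unit; rewrite mulKmx. Qed.

Lemma isotropyKV A (x : 'cV[R]_n) : isotropy br ip A -> A *m (invmx A *m x) = x.
Proof. by move=> /isotropy_unit A_unit; rewrite mulKVmx. Qed.

Lemma isotropy_br A x y : isotropy br ip A ->
  A *m br x y = br (A *m x) (A *m y).
Proof. by case. Qed.

Lemma isotropy_ip A x y : isotropy br ip A -> ip (A *m x) (A *m y) = ip x y.
Proof. by case. Qed.

Lemma isotropy_adj A x y : isotropy br ip A ->
  ip (A *m x) y = ip x (invmx A *m y).
Proof. by move=> HA; rewrite -(isotropy_ip x (invmx A *m y) HA) isotropyKV. Qed.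

Lemma isotropy_stable_center A z : br 0 =1 cst 0 -> isotropy br ip A ->
  lie_center br z -> lie_center br (A *m z).
Proof.
move=> br0 HA z_center x.
by rewrite -(isotropyKV x HA) -(isotropy_br _ _ HA) z_center mulmx0.
Qed.

Lemma normal_in_isotropy0 : br 0 =1 cst 0 ->
  normal_in (isotropy0 br ip) (isotropy br ip).
Proof.
move=> br0.
have H1 : isotropy br ip 1%:M by case: matrix_group_isotropy.
split=> [|A []//|A B HA [HB B_center]].
  split=> [|A B [HA Az] [HB Bz]|A [HA Az]].
  - by split=> // z _; rewrite mul1mx.
  - by split=> [|z zz]; [exact: isotropyM|rewrite -mulmxA Bz// Az].
  - split; first exact: isotropy_unit.
    split=> [|z zz]; first exact: isotropyV.
    by rewrite -{1}(Az z zz) isotropyK.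
split=> [|z zz]; first exact: (isotropyM (isotropyM HA HB) (isotropyV HA)).
rewrite -!mulmxA B_center ?isotropyKV//.
exact: isotropy_stable_center (isotropyV HA) zz.
Qed.

End IsotropyGroup.

(** * Isometric automorphisms of a bracket given by weight vectors *)

Section WeightModel.
Variables (R : realType) (n : nat) (ip : 'cV[R]_n -> 'cV[R]_n -> R).
Hypothesis ip_inner : inner_product ip.
Variables (k : nat) (r : 'I_k -> nat).
Variables (X Y : forall p : 'I_k, 'I_(r p) -> 'cV[R]_n).
Arguments X : clear implicits.
Arguments Y : clear implicits.
Hypothesis XY_orthonormal : forall p (i : 'I_(r p)) q (j : 'I_(r q)),
  let delta : R := ((p == q) && (i == j :> nat))%:R in
  [/\ ip (X p i) (X q j) = delta, ip (Y p i) (Y q j) = delta &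
      ip (X p i) (Y q j) = 0].
Hypothesis r_gt0 : forall p, (0 < r p)%N.
Local Notation fromC := (from_complex X Y).
Local Notation coords := (coords ip X Y).
Local Notation zpart := (zpart ip X Y).
Local Notation omega := (omega ip X Y).
Variable Zw : 'I_k -> 'cV[R]_n.
Hypothesis coords_Zw : forall p q, coords q (Zw p) = 0.
Hypothesis Zw_span : forall z, (forall p, coords p z = 0) ->
  exists c : 'I_k -> R, z = \sum_p c p *: Zw p.
Hypothesis Zw_neq0 : forall p, Zw p != 0.
Hypothesis Zw_inj : forall p q, Zw p = Zw q \/ Zw p = - Zw q -> p = q.
Variable br : 'cV[R]_n -> 'cV[R]_n -> 'cV[R]_n.
Hypothesis brE : forall x y, br x y = \sum_p omega p x y *: Zw p.
Implicit Types (x y z : 'cV[R]_n) (a : R) (p q : 'I_k) (A B : 'M[R]_n).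
Local Notation H := (isotropy br ip).
Local Notation H0 := (isotropy0 br ip).

Lemma omega0l p z x : coords p z = 0 -> omega p z x = 0.
Proof.
by move=> z0; rewrite /omega z0 trmx0 (map_mx0 Num.conj) mul0mx mxE.
Qed.

Lemma br0 : br 0 =1 cst 0.
Proof. by move=> x; rewrite brE big1// => p _; rewrite omega0l ?scale0r ?coords0. Qed.

Lemma coords_br p x y : coords p (br x y) = 0.
Proof.
by rewrite brE coords_sum// big1// => q _; rewrite coordsZ// coords_Zw scaler0.
Qed.

Lemma br_fromC p z (w : 'cV[R[i]]_(r p)) :
  br z (fromC w) = complex.Im (((coords p z)^t* *m w) 0 0) *: Zw p.
Proof.
rewrite brE (bigD1 p)//= big1 ?addr0 => [|q qp].
  by rewrite /omega coords_fromC.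
by rewrite /omega coords_fromC_neq 1?eq_sym// mulmx0 mxE scale0r.
Qed.

(** Bracketing with the p-th component isolates the nonzero vector [Zw p], and omega_p is
    nondegenerate on that component. *)
Lemma lie_centerP z : lie_center br z <-> forall p, coords p z = 0.
Proof.
split=> [z_center p|z0 x]; last first.
  by rewrite brE big1// => p _; rewrite omega0l ?scale0r.
have Im0 (w : 'cV[R[i]]_(r p)) : complex.Im (((coords p z)^t* *m w) 0 0) = 0.
  have /eqP := z_center (fromC w); rewrite br_fromC scaler_eq0.
  by rewrite (negbTE (Zw_neq0 p)) orbF => /eqP.
move: (coords p z) Im0 => c Im0; apply/colP => i; rewrite [RHS]mxE.
have Imc d : complex.Im ((c i 0)^* * d) = 0.
  have := Im0 (d *: delta_mx i 0).
  by rewrite -scalemxAr -colE !mxE mulrC.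
have := Imc 1; have := Imc 'i; case: (c i 0) => a b /=.
by rewrite !(mulr0, mulr1, addr0, add0r) => -> /eqP; rewrite oppr_eq0 => /eqP ->.
Qed.

(** The J-map expressed by weights and extended to all arguments: it is zero on vectors [x] without
    coordinates and depends on [z] through its products with the [Zw p] only. So [ip_br] holds
    without restriction on x, y, z. *)
Definition Jop z x : 'cV[R]_n :=
  \sum_p ip (Zw p) z *: fromC ('i *: coords p x).

Lemma ip_br x y z : ip (br x y) z = ip (Jop z x) y.
Proof.
rewrite brE !ip_suml//; apply: eq_bigr => p _.
by rewrite !ipZl// omega_ip// mulrC.
Qed.

(** By [ip_br] and nondegeneracy, [Jop] is determined by the bracket and the inner product, both of
    which [A] preserves. *)
Lemma Jop_isotropy A z x : H A -> A *m Jop z x = Jop (A *m z) (A *m x).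
Proof.
move=> HA; apply: (ip_nondegenerate ip_inner) => y.
have -> : ip (A *m Jop z x) y = ip (br x (invmx A *m y)) z.
  by rewrite (isotropy_adj _ _ HA) ip_br.
rewrite -ip_br -(isotropy_ip (br _ _) z HA) (isotropy_br _ _ HA).
by rewrite (isotropyKV _ HA).
Qed.

Lemma coords_Jop p z x :
  coords p (Jop z x) = (ip (Zw p) z)%:C *: ('i *: coords p x).
Proof.
rewrite /Jop -[RHS](coords_sum_fromC ip_inner XY_orthonormal p
  (fun p => (ip (Zw p) z)%:C *: ('i *: coords p x))).
by congr (coords p _); apply: eq_bigr => q _; rewrite fromCZ.
Qed.

Lemma Jop_fromC p z (w : 'cV[R[i]]_(r p)) :
  Jop z (fromC w) = ip (Zw p) z *: fromC ('i *: w).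
Proof.
rewrite /Jop (bigD1 p)//= big1 ?addr0 => [|q qp]; first by rewrite coords_fromC.
by rewrite coords_fromC_neq 1?eq_sym// scaler0 fromC0 scaler0.
Qed.

(* J_Z^2 is the scalar -(lambda_p Z)^2 on the p-th isotypic component. *)
Lemma isotropy_weight A p q (w : 'cV[R[i]]_(r p)) :
  H A -> coords q (A *m fromC w) != 0 ->
  A *m Zw p = Zw q \/ A *m Zw p = - Zw q.
Proof.
move=> HA c0.
apply: (eq_or_opp_of_ip_sqr ip_inner (S := [set: 'cV[R]_n])) => // z _.
rewrite -(isotropyKV z HA); set z' := invmx A *m z.
rewrite (isotropy_ip _ _ HA).
have JJ : coords q (A *m Jop z' (Jop z' (fromC w))) =
    - ((ip (Zw p) z') ^+ 2)%:C *: coords q (A *m fromC w).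
  rewrite Jop_fromC -fromCZ Jop_fromC -fromCZ.
  have -> : (ip (Zw p) z')%:C *: ('i *: ((ip (Zw p) z')%:C *: ('i *: w))) =
      (- (ip (Zw p) z') ^+ 2)%:C *: w.
    rewrite !scalerA; congr (_ *: _).
    by apply: complex_eq; rewrite /= ?mulr0 ?mul0r; ring.
  by rewrite fromCZ -scalemxAr coordsZ// rmorphN.
move: JJ; rewrite !(Jop_isotropy _ _ HA) !coords_Jop => /eqP.
rewrite -subr_eq0 !scalerA -scalerBl scaler_eq0 (negbTE c0) orbF.
have -> : A *m z' = z by rewrite (isotropyKV _ HA).
move=> /eqP /(congr1 (@complex.Re R)).
set s := ip _ z; set t := ip _ z'.
rewrite /= ?mulr0 ?mul0r => st.
by apply/eqP; rewrite -subr_eq0 -st; apply/eqP; ring.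
Qed.

Lemma isotropy_coords0 A z : H A ->
  (forall p, coords p z = 0) -> forall p, coords p (A *m z) = 0.
Proof.
move=> HA /lie_centerP z_center; apply/lie_centerP.
exact: isotropy_stable_center br0 HA z_center.
Qed.

(** A nonzero coordinate of the image in another component q' would give Z_q = Z_q' up to sign by
    [isotropy_weight], contradicting [Zw_inj]. The remaining central part is killed by
    orthogonality. *)
Lemma isotropy_fromC A p q (w : 'cV[R[i]]_(r p)) :
  H A -> A *m Zw p = Zw q \/ A *m Zw p = - Zw q ->
  A *m fromC w = fromC (coords q (A *m fromC w)).
Proof.
move=> HA Apq; set f := fromC w.
have coords_Af q' : q' != q -> coords q' (A *m f) = 0.
  move=> q'q; apply/eqP; apply: contraNT q'q => /(isotropy_weight HA) Apq'.
  apply/eqP; apply: Zw_inj.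
  case: Apq' Apq => -> [] E; [left|right|right|left] => //.
  - by rewrite -E opprK.
  - exact: oppr_inj.
set u := zpart (A *m f).
have u0 p' : coords p' u = 0 by exact: coords_zpart.
(* Both <u, u> and <f, A^-1 u> equal <A f, u>, and A^-1 u is again central, hence orthogonal to
   f. *)
have /eqP : ip u u = 0.
  have : ip (A *m f) u = 0.
    rewrite (isotropy_adj _ _ HA) ip_fromC_perp//.
    exact: (isotropy_coords0 (isotropyV HA)).
  rewrite {1}[A *m f](zpartK ip X Y) ipDl// ip_suml// [X in _ + X]big1 ?addr0//.
  by move=> q' _; rewrite ip_fromC_perp.
rewrite ip_eq0// => /eqP u_eq0.
rewrite {1}[A *m f](zpartK ip X Y) -/u u_eq0 add0r (bigD1 q)//= big1 ?addr0//.
by move=> q' q'q; rewrite coords_Af// fromC0.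
Qed.

(** Otherwise [A] would send a basis vector of the p-th component into the center, and A^-1, which
    preserves the center, would make that vector central. *)
Lemma isotropy_weight_exists A p : H A ->
  exists q, A *m Zw p = Zw q \/ A *m Zw p = - Zw q.
Proof.
move=> HA; pose w : 'cV[R[i]]_(r p) := delta_mx (Ordinal (r_gt0 p)) 0.
have [[q] |] := pselect (exists q, coords q (A *m fromC w) != 0).
  by move=> /(isotropy_weight HA); exists q.
move=> /forallNP all0.
have /(isotropy_coords0 (isotropyV HA)) : forall q, coords q (A *m fromC w) = 0.
  by move=> q; have /negP/negPn/eqP := all0 q.
move=> /(_ p); rewrite (isotropyK _ HA) coords_fromC//.
move=> /colP /(_ (Ordinal (r_gt0 p))) /eqP.
by rewrite !mxE !eqxx oner_eq0.
Qed.

(** * Preservation of the multiplicities *)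

Lemma ip_fromC_self p (w : 'cV[R[i]]_(r p)) : ip (fromC w) (fromC w) =
  \sum_i (ip (fromC w) (X p i) ^+ 2 + ip (fromC w) (Y p i) ^+ 2).
Proof.
rewrite {1}/from_complex ip_suml//; apply: eq_bigr => i _.
rewrite ipDl// !ipZl// ![ip _ (fromC w)]ipC//.
have /colP/(_ i) := coords_fromC ip_inner XY_orthonormal w.
by rewrite mxE => <-; rewrite /= -!expr2.
Qed.

Lemma ip_X p i : ip (X p i) (X p i) = 1.
Proof. by have [-> _ _] := XY_orthonormal i i; rewrite !eqxx. Qed.

Lemma ip_Y p i : ip (Y p i) (Y p i) = 1.
Proof. by have [_ -> _] := XY_orthonormal i i; rewrite !eqxx. Qed.

(* Computed from the columns of A, then from those of A^-1 (its transpose), this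
   sum equals 2 r_p and 2 r_q. *)
Let entries A p q : R := \sum_i \sum_j
  (ip (A *m X p i) (X q j) ^+ 2 + ip (A *m X p i) (Y q j) ^+ 2 +
  (ip (A *m Y p i) (X q j) ^+ 2 + ip (A *m Y p i) (Y q j) ^+ 2)).

Lemma entriesE A p q : H A -> A *m Zw p = Zw q \/ A *m Zw p = - Zw q ->
  entries A p q = ((r p).*2)%:R.
Proof.
move=> HA Apq; rewrite /entries -muln2 mulnC natrM mulr_natr -[r p in RHS]card_ord.
rewrite -[RHS]sumr_const; apply: eq_bigr => i _; rewrite big_split /=.
have AX : A *m X p i = fromC (coords q (A *m X p i)).
  by rewrite -(fromC_delta X Y); exact: isotropy_fromC.
have AY : A *m Y p i = fromC (coords q (A *m Y p i)).
  by rewrite -(fromC_idelta X Y); exact: isotropy_fromC.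
rewrite AX AY -!ip_fromC_self -AX -AY !(isotropy_ip _ _ HA) ip_X ip_Y.
by rewrite -mulr2n.
Qed.

Lemma isotropy_multiplicity A p q :
  H A -> A *m Zw p = Zw q \/ A *m Zw p = - Zw q -> r p = r q.
Proof.
move=> HA Apq.
have Vqp : invmx A *m Zw q = Zw p \/ invmx A *m Zw q = - Zw p.
  case: Apq => E; [left|right]; first by rewrite -E (isotropyK _ HA).
  by rewrite -[Zw q]opprK -E mulmxN (isotropyK _ HA).
apply: double_inj; apply/eqP; rewrite -(eqr_nat R).
rewrite -(entriesE HA Apq) -(entriesE (isotropyV HA) Vqp) /entries exchange_big.
apply/eqP; apply: eq_bigr => j _; apply: eq_bigr => i _ /=.
rewrite !(isotropy_adj _ _ HA) ![ip _ (invmx A *m _)]ipC//.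
by rewrite addrACA.
Qed.

Lemma sub_center_linear (S : set 'cV[R]_n) :
  (forall a x y, S x -> S y -> S (a *: x + y)) -> S 0 ->
  (forall p, S (Zw p)) -> forall z, (forall p, coords p z = 0) -> S z.
Proof.
move=> S_lin S0 SZ z /Zw_span[c ->].
have SD x y : S x -> S y -> S (x + y).
  by move=> Sx Sy; rewrite -[x]scale1r; exact: S_lin.
apply: (big_ind S) => // p _; rewrite -[_ *: _]addr0; exact: S_lin.
Qed.

Lemma eq_mx_on_center A B : (forall p, A *m Zw p = B *m Zw p) ->
  forall z, (forall p, coords p z = 0) -> A *m z = B *m z.
Proof.
move=> AB; apply: sub_center_linear => [a x y|//|].
- by rewrite !mulmxDr -!scalemxAr => -> ->.
- by rewrite !mulmx0.
- exact: AB.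
Qed.

Lemma eq_mx_of_generators A B : (forall p, A *m Zw p = B *m Zw p) ->
  (forall p i, A *m X p i = B *m X p i) ->
  (forall p i, A *m Y p i = B *m Y p i) -> A = B.
Proof.
move=> ABZ ABX ABY; apply: col_mx_inj; apply: (vec_ind ip_inner XY_orthonormal).
- by move=> a x y Ex Ey; rewrite !mulmxDr -!scalemxAr Ex Ey.
- exact: eq_mx_on_center.
- exact: ABX.
- exact: ABY.
Qed.

Lemma isotropy0P A : H0 A <-> H A /\ forall p, A *m Zw p = Zw p.
Proof.
split=> [[HA AZ]|[HA AZ]].
  by split=> // p; apply: AZ; apply/lie_centerP => q; exact: coords_Zw.
split=> // z /lie_centerP z0.
by rewrite -[RHS]mul1mx; apply: eq_mx_on_center z0 => p; rewrite mul1mx.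
Qed.

(** * Signed permutations of the weight vectors *)

Lemma signed_Zw_inj (e e' : bool) p q :
  (-1) ^+ e *: Zw p = (-1) ^+ e' *: Zw q -> p = q /\ e = e'.
Proof.
have pm (b : bool) (x : 'cV[R]_n) : (-1) ^+ b *: x = if b then - x else x.
  by case: b; rewrite ?expr1 ?scaleN1r ?expr0 ?scale1r.
rewrite !pm => E.
have pq : p = q.
  apply: Zw_inj; case: e e' E => [] [] E.
  - by left; exact: oppr_inj.
  - by right; rewrite -E opprK.
  - by right.
  - by left.
split=> //; have ZqN : Zw q <> - Zw q.
  move/eqP; rewrite -addr_eq0 -mulr2n -scaler_nat scaler_eq0 pnatr_eq0.
  by rewrite (negbTE (Zw_neq0 q)).
by move: E; rewrite pq; case: e e' => [] [] // /esym/ZqN.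
Qed.

(** The equality of multiplicities is recorded because it is what [cast_ord] needs to carry basis
    indices from one component to the other. *)
Definition acts_by (t : signed_perm k) A := forall p,
  r p = r (t.1 p) /\ A *m Zw p = (-1) ^+ t.2 p *: Zw (t.1 p).

(** The vectors Z_p and -Z_p are pairwise distinct, so the action determines the signed permutation.
    Identities between signed permutations thus reduce to matrix identities on the [Zw p]. *)
Lemma acts_by_uniq t t' A B :
  acts_by t A -> acts_by t' B -> (forall p, A *m Zw p = B *m Zw p) -> t = t'.
Proof.
case: t t' => [s e] [s' e'] tA tB AB.
have E p : s p = s' p /\ e p = e' p.
  have [_ AE] := tA p; have [_ BE] := tB p.
  by apply: signed_Zw_inj; rewrite -[LHS]AE -[RHS]BE.
by congr pair; [apply/permP|apply/ffunP] => p; case: (E p).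
Qed.

Lemma acts_byM t t' A B : acts_by t A -> acts_by t' B ->
  acts_by (signed_perm_mul t t') (A *m B).
Proof.
move=> tA tB p; have [rB BZ] := tB p; have [rA AZ] := tA (t'.1 p).
rewrite /signed_perm_mul /= permM ffunE; split; first by rewrite rB.
by rewrite -mulmxA BZ -scalemxAr AZ scalerA -signr_addb.
Qed.

(** Injectivity of [A] on the center makes the chosen index map injective, hence a permutation. The
    hypotheses also fit a matrix of [Gamma_lift] not yet known to lie in H. *)
Lemma acts_by_exists A :
  (forall p, exists q, r p = r q /\ (A *m Zw p = Zw q \/ A *m Zw p = - Zw q)) ->
  (forall z, (forall p, coords p z = 0) -> A *m z = 0 -> z = 0) ->
  exists t, acts_by t A.
Proof.
move=> AZ A_inj; have [s sP] := choice AZ.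
have AZ_inj (b : bool) p q : A *m Zw p = (-1) ^+ b *: (A *m Zw q) -> p = q.
  move=> E; apply/esym; apply: (@signed_Zw_inj b 0 _ _ _).1.
  apply/eqP; rewrite expr0 scale1r -subr_eq0; apply/eqP/A_inj => [p'|].
    by rewrite coordsD// coordsN// coordsZ// !coords_Zw scaler0 subr0.
  by rewrite mulmxBr -scalemxAr -E subrr.
have s_inj : injective s.
  move=> p q spq; have [_ Ap] := sP p; have [_] := sP q; rewrite -spq => Aq.
  case: Ap Aq => Ap [] Aq; [apply: (AZ_inj false)|apply: (AZ_inj true)|
    apply: (AZ_inj true)|apply: (AZ_inj false)];
    by rewrite Ap Aq ?expr0 ?scale1r ?expr1 ?scaleN1r ?opprK.
(* The sign is minus exactly when [A] fails to send Z_p to Z_(s p) itself. *)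
exists (perm s_inj, [ffun p => A *m Zw p != Zw (s p)]) => p /=.
rewrite permE ffunE; have [rp [->|->]] := sP p; split=> //.
  by rewrite eqxx expr0 scale1r.
suff -> : - Zw (s p) != Zw (s p) by rewrite expr1 scaleN1r.
apply/eqP => E; suff : true = false by [].
by apply: (@signed_Zw_inj _ _ (s p) (s p) _).2; rewrite expr0 expr1 scale1r scaleN1r.
Qed.

Lemma isotropy_acts_by A : H A -> exists t, acts_by t A.
Proof.
move=> HA; apply: acts_by_exists => [p|z _ Az].
  have [q Apq] := isotropy_weight_exists p HA.
  by exists q; split=> //; exact: isotropy_multiplicity Apq.
by rewrite -(isotropyK z HA) Az mulmx0.
Qed.

Lemma isotropy_quotient : quotient_embeds_in_signed_perms ip r Zw H H0.
Proof.
(* Unique choice on H; elsewhere [rho] takes some value of no significance. *)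
pose rho A := xget (1%g, [ffun=> false]) [set t | acts_by t A].
have rhoP A : H A -> acts_by (rho A) A.
  move=> /isotropy_acts_by[t tA].
  by apply: (@xgetPex _ _ [set t | acts_by t A]); exists t.
exists rho; split=> [A p /rhoP /(_ p)[]//|A p HA q|A B HA HB|A B HA HB].
- have [rpq AZ] := rhoP _ HA p; split=> //.
  rewrite -(isotropy_ip _ _ HA) AZ ipZl// ipZr// mulrA -signr_addb addbb.
  by rewrite expr0 mul1r.
- apply: (acts_by_uniq (rhoP _ (isotropyM HA HB))) => //.
  by apply: acts_byM; exact: rhoP.
- split=> [rhoAB|[C /isotropy0P[HC CZ] BE]].
    exists (invmx A *m B); last by rewrite (mulKVmx (isotropy_unit HA)).
    apply/isotropy0P; split=> [|p]; first exact: (isotropyM (isotropyV HA) HB).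
    have [_ AZ] := rhoP _ HA p; have [_ BZ] := rhoP _ HB p.
    by rewrite -mulmxA BZ -rhoAB -AZ (isotropyK _ HA).
  apply: (acts_by_uniq (rhoP _ HA) (rhoP _ HB)) => p.
  by rewrite BE -mulmxA CZ.
Qed.

(** * Lifts of signed permutations *)

(** On the p-th component such a map is the standard identification with the target component,
    composed with complex conjugation when the sign is minus. *)
Definition lifts t A := acts_by t A /\
  forall p (i : 'I_(r p)) (j : 'I_(r (t.1 p))), i = j :> nat ->
    A *m X p i = X (t.1 p) j /\ A *m Y p i = (-1) ^+ t.2 p *: Y (t.1 p) j.

(** Isometry on the center has to be assumed: a signed permutation alone says nothing about the
    angles between the [Zw p]. The bracket is preserved because omega_p and Z_p pick up the same
    sign, and the two signs cancel. *)
Lemma lifts_isotropy t A : lifts t A ->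
  (forall z z', (forall p, coords p z = 0) -> (forall p, coords p z' = 0) ->
    ip (A *m z) (A *m z') = ip z z') -> H A.
Proof.
move=> [tA AXY] A_center.
have cast_eq p (i : 'I_(r p)) : i = cast_ord (tA p).1 i :> nat by [].
have AX p i := (AXY p i _ (cast_eq p i)).1.
have AY p i := (AXY p i _ (cast_eq p i)).2.
have coords_A z : (forall p, coords p z = 0) -> forall p, coords p (A *m z) = 0.
  apply: (sub_center_linear (S := [set z | forall p, coords p (A *m z) = 0]))
    => [a x y x0 y0 p|p|p q] /=.
  - by rewrite mulmxDr -scalemxAr coordsP// x0 y0 scaler0 addr0.
  - by rewrite mulmx0 coords0.
  - by rewrite (tA p).2 coordsZ// coords_Zw scaler0.
have ip_Xz p i z : (forall p, coords p z = 0) -> ip (X p i) z = 0.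
  by move=> z0; rewrite -(fromC_delta X Y) ip_fromC_perp.
have ip_Yz p i z : (forall p, coords p z = 0) -> ip (Y p i) z = 0.
  by move=> z0; rewrite -(fromC_idelta X Y) ip_fromC_perp.
have t_inj p q : (t.1 p == t.1 q) = (p == q) by rewrite (inj_eq perm_inj).
have A_iso x y : ip (A *m x) (A *m y) = ip x y.
  elim/(vec_ind ip_inner XY_orthonormal) : x => [a x x' IHx IHx'|z z0|p i|p i].
  - by rewrite mulmxDr -scalemxAr !ipPl// IHx IHx'.
  - elim/(vec_ind ip_inner XY_orthonormal) : y => [a y y' IHy IHy'|z' z'0|q j|q j].
    + by rewrite mulmxDr -scalemxAr !ipPr// IHy IHy'.
    + exact: A_center.
    + by rewrite AX ![ip _ (X _ _)]ipC// !ip_Xz//; exact: coords_A.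
    + by rewrite AY ipZr// ![ip _ (Y _ _)]ipC// !ip_Yz ?mulr0//; exact: coords_A.
  - elim/(vec_ind ip_inner XY_orthonormal) : y => [a y y' IHy IHy'|z' z'0|q j|q j].
    + by rewrite mulmxDr -scalemxAr !ipPr// IHy IHy'.
    + by rewrite AX !ip_Xz//; exact: coords_A.
    + rewrite !AX; have [-> _ _] := XY_orthonormal i j.
      by have [-> _ _] := XY_orthonormal (cast_ord (tA p).1 i) (cast_ord (tA q).1 j);
        rewrite t_inj.
    + rewrite AX AY ipZr//; have [_ _ ->] := XY_orthonormal i j.
      have [_ _ ->] := XY_orthonormal (cast_ord (tA p).1 i) (cast_ord (tA q).1 j).
      by rewrite mulr0.
  - elim/(vec_ind ip_inner XY_orthonormal) : y => [a y y' IHy IHy'|z' z'0|q j|q j].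
    + by rewrite mulmxDr -scalemxAr !ipPr// IHy IHy'.
    + by rewrite AY ipZl// !ip_Yz ?mulr0//; exact: coords_A.
    + rewrite AX AY ipZl// ![ip _ (X _ _)]ipC//; have [_ _ ->] := XY_orthonormal j i.
      have [_ _ ->] := XY_orthonormal (cast_ord (tA q).1 j) (cast_ord (tA p).1 i).
      by rewrite mulr0.
    + rewrite !AY ipZl// ipZr//; have [_ -> _] := XY_orthonormal i j.
      have [_ -> _] := XY_orthonormal (cast_ord (tA p).1 i) (cast_ord (tA q).1 j).
      rewrite t_inj /=; have [pq|pq] := eqVneq p q; last by rewrite !mulr0.
      have -> : t.2 p = t.2 q by rewrite pq.
      by rewrite mulrA -signr_addb addbb expr0 mul1r.
split=> //; first exact: ip_isometry_unitmx A_iso.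
(* The p-th term on the left is matched with the term of index [t.1 p] on the right, and likewise
   for the bases of the two components. *)
move=> x y; rewrite !brE mulmx_sumr [RHS](reindex_inj (@perm_inj _ t.1)).
apply: eq_bigr => p _; rewrite -scalemxAr (tA p).2 scalerA; congr (_ *: _).
rewrite !omegaE mulr_suml [RHS](reindex (cast_ord (tA p).1)) /=; last first.
  by apply: onW_bij; exists (cast_ord (esym (tA p).1)) => i; apply: val_inj.
apply: eq_bigr => i _.
have ipY v : ip (A *m v) (Y (t.1 p) (cast_ord (tA p).1 i)) =
    (-1) ^+ t.2 p * ip v (Y p i).
  rewrite -(A_iso v) AY ipZr// mulrA -signr_addb addbb expr0 mul1r//.
by rewrite -!AX !A_iso !ipY; ring.
Qed.

(** Since Z_q and -Z_q differ, the two sign clauses of [Gamma_lift] assemble into one signed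
    permutation; the isometry [phi] supplies what [lifts_isotropy] assumes on the center. *)
Lemma Gamma_liftP A :
  Gamma_lift br ip X Y Zw A <-> H A /\ exists t, lifts t A.
Proof.
have Zc p : lie_center br (Zw p) by apply/lie_centerP => q; exact: coords_Zw.
split=> [[phi [[phi_center phi_lin phi_iso phi_Z] AE A_pos A_neg]]|].
  have A_iso z z' : (forall p, coords p z = 0) -> (forall p, coords p z' = 0) ->
      ip (A *m z) (A *m z') = ip z z'.
    by move=> /lie_centerP z0 /lie_centerP z'0; rewrite !AE// phi_iso.
  have [|z z0 Az0|t tA] := @acts_by_exists A.
  - by move=> p; have [q [rpq E]] := phi_Z p; exists q; rewrite AE.
  - by apply/eqP; rewrite -(ip_eq0 ip_inner) -A_iso// Az0 ip0l.
  have lA : lifts t A.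
    split=> // p i j ij; have [_] := tA p; rewrite AE//; case: (t.2 p).
      rewrite expr1 scaleN1r => /A_neg /(_ _ _ ij) [-> ->].
      by rewrite scaleN1r.
    rewrite expr0 scale1r => /A_pos /(_ _ _ ij) [-> ->].
    by rewrite scale1r.
  by split; [exact: lifts_isotropy lA A_iso|exists t].
move=> [HA [t [tA AXY]]]; exists (mulmx A); split=> //.
- split=> [z zc|c z z' _ _|z z' _ _|p].
  + exact: isotropy_stable_center br0 HA zc.
  + by rewrite mulmxDr -scalemxAr.
  + exact: (isotropy_ip _ _ HA).
  + exists (t.1 p); have [rp ->] := tA p; split=> //.
    by case: (t.2 p); [right|left]; rewrite ?expr1 ?scaleN1r ?expr0 ?scale1r.
- move=> p q; have [_ ->] := tA p; rewrite -[Zw q]scale1r => E i j ij.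
  have [pq e0] := @signed_Zw_inj (t.2 p) false _ _ E.
  move: j ij; case: _ / pq => j ij.
  by have := AXY p i j ij; rewrite e0 expr0 scale1r.
- move=> p q; have [_ ->] := tA p; rewrite -[- Zw q]scaleN1r => E i j ij.
  have [pq e1] := @signed_Zw_inj (t.2 p) true _ _ E.
  move: j ij; case: _ / pq => j ij.
  by have := AXY p i j ij; rewrite e1 expr1 scaleN1r.
Qed.

(** The lift copies [A] on the center, where the isometry is then inherited, and moves the adapted
    bases by the signed permutation of [A]. *)
Lemma lift_exists A : H A ->
  exists2 B, Gamma_lift br ip X Y Zw B & forall p, B *m Zw p = A *m Zw p.
Proof.
move=> HA; have [t tA] := isotropy_acts_by HA.
pose g x := A *m zpart x + \sum_p \sum_(i < r p)
  (ip x (X p i) *: X (t.1 p) (cast_ord (tA p).1 i) +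
   ip x (Y p i) *: ((-1) ^+ t.2 p *: Y (t.1 p) (cast_ord (tA p).1 i))).
have g_lin : linear g.
  move=> a x y; rewrite /g zpart_linear// mulmxDr -scalemxAr scalerDr addrACA.
  congr (_ + _); rewrite scaler_sumr -big_split; apply: eq_bigr => p _ /=.
  rewrite scaler_sumr -big_split; apply: eq_bigr => i _ /=.
  by rewrite !ipPl// !scalerDl -!scalerA scalerDr addrACA.
have g_center z : (forall p, coords p z = 0) -> g z = A *m z.
  move=> z0; rewrite /g zpart_id// big1 ?addr0// => p _; rewrite big1// => i _.
  rewrite -(fromC_delta X Y) -(fromC_idelta X Y) ![ip z _]ipC//.
  by rewrite !ip_fromC_perp// !scale0r addr0.
have g_fromC p (w : 'cV[R[i]]_(r p)) : g (fromC w) = \sum_(i < r p)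
  (complex.Re (w i 0) *: X (t.1 p) (cast_ord (tA p).1 i) +
   complex.Im (w i 0) *: ((-1) ^+ t.2 p *: Y (t.1 p) (cast_ord (tA p).1 i))).
  have coordsE q i : ip (fromC w) (X q i) = complex.Re (coords q (fromC w) i 0) /\
      ip (fromC w) (Y q i) = complex.Im (coords q (fromC w) i 0).
    by rewrite !mxE.
  rewrite /g [zpart _](_ : _ = 0) ?mulmx0 ?add0r; last first.
    rewrite /zpart (bigD1 p)//= coords_fromC// big1 ?addr0 ?subrr// => q qp.
    by rewrite coords_fromC_neq 1?eq_sym// fromC0.
  rewrite (bigD1 p)//= [X in _ + X]big1 ?addr0 => [|q qp].
    by apply: eq_bigr => i _; have [-> ->] := coordsE p i; rewrite coords_fromC.
  rewrite big1// => i _; have [-> ->] := coordsE q i.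
  by rewrite coords_fromC_neq 1?eq_sym// mxE !scale0r addr0.
have gX p i : g (X p i) = X (t.1 p) (cast_ord (tA p).1 i).
  rewrite -(fromC_delta X Y) g_fromC (bigD1 i)//= big1 ?addr0 => [|j /negbTE ji].
    by rewrite mxE !eqxx scale1r scale0r addr0.
  by rewrite mxE ji !scale0r addr0.
have gY p i : g (Y p i) = (-1) ^+ t.2 p *: Y (t.1 p) (cast_ord (tA p).1 i).
  rewrite -(fromC_idelta X Y) g_fromC (bigD1 i)//= big1 ?addr0 => [|j /negbTE ji].
    by rewrite !mxE !eqxx mulr1 scale0r add0r scale1r.
  by rewrite !mxE ji mulr0 !scale0r addr0.
exists (linfun_mx g) => [|p]; last by rewrite linfun_mxE ?g_center.
have lg : lifts t (linfun_mx g).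
  split=> [p|p i j ij]; first by rewrite linfun_mxE// g_center//; exact: tA.
  rewrite !linfun_mxE// gX gY.
  by have -> : cast_ord (tA p).1 i = j by exact: val_inj.
apply/Gamma_liftP; split; last by exists t.
apply: lifts_isotropy lg _ => z z' z0 z'0.
by rewrite !linfun_mxE// !g_center// (isotropy_ip _ _ HA).
Qed.

(** If B is the lift that agrees with A on the center, then B^-1 A fixes every Z_p. *)
Lemma isotropy_eq_lift_mul :
  H = [set A *m B | A in Gamma_lift br ip X Y Zw & B in H0].
Proof.
apply/seteqP; split=> [A HA|_ [A /Gamma_liftP[HA _] [B [HB _] <-]]]; last first.
  exact: isotropyM.
have [B GB BZ] := lift_exists HA; have [HB _] := (Gamma_liftP B).1 GB.
exists B => //; exists (invmx B *m A); last by rewrite (mulKVmx (isotropy_unit HB)).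
apply/isotropy0P; split=> [|p]; first exact: (isotropyM (isotropyV HB) HA).
by rewrite -mulmxA -BZ (isotropyK _ HB).
Qed.

Lemma eq_of_lifts t A B : lifts t A -> lifts t B -> A = B.
Proof.
move=> [tA AXY] [tB BXY].
have cast_eq p (i : 'I_(r p)) : i = cast_ord (tA p).1 i :> nat by [].
apply: eq_mx_of_generators => p.
- by rewrite (tA p).2 (tB p).2.
- by move=> i; rewrite (AXY p i _ (cast_eq p i)).1 (BXY p i _ (cast_eq p i)).1.
- by move=> i; rewrite (AXY p i _ (cast_eq p i)).2 (BXY p i _ (cast_eq p i)).2.
Qed.

(** A lift is determined by its signed permutation, and these form a finite type. Signed
    permutations without a lift contribute the default matrix of [xget], harmless for an upper
    bound. *)
Lemma finite_Gamma_lift : finite_set (Gamma_lift br ip X Y Zw).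
Proof.
apply: (@sub_finite_set _ _ ((fun t => xget 0 [set A | lifts t A]) @` setT)).
  move=> A /Gamma_liftP[_ [t tA]]; exists t => //.
  exact: xget_unique (fun B tB => eq_of_lifts tB tA).
exact/finite_image/finite_finset.
Qed.

Lemma matrix_group_Gamma_lift : matrix_group (Gamma_lift br ip X Y Zw).
Proof.
(* The index types ['I_(r p)] vary with p, so basis vectors are compared through the equality of
   components and of the underlying numbers. *)
have nat_ord p q (i : 'I_(r p)) (j : 'I_(r q)) : p = q -> i = j :> nat ->
    X p i = X q j /\ Y p i = Y q j.
  by move=> pq; case: _ / pq j => j /val_inj ->.
have signZK (b : bool) (v : 'cV[R]_n) : (-1) ^+ b *: ((-1) ^+ b *: v) = v.
  by rewrite scalerA -signr_addb addbb scale1r.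
have [H1 _ _] := matrix_group_isotropy br ip.
split=> [|A B /Gamma_liftP[HA [t [tA tAXY]]] /Gamma_liftP[HB [t' [tB tBXY]]]|
    A /Gamma_liftP[HA [t [tA tAXY]]]].
- apply/Gamma_liftP; split=> //; exists (1%g, [ffun=> false]).
  split=> [p|p i j] /=; first by rewrite perm1 ffunE mul1mx scale1r.
  move=> ij; rewrite !mul1mx ffunE scale1r.
  by apply: nat_ord => //; rewrite perm1.
- apply/Gamma_liftP; split; first exact: isotropyM.
  exists (signed_perm_mul t t'); split; first exact: acts_byM.
  move=> p i j ij.
  have /(tBXY p i _) : i = cast_ord (tB p).1 i :> nat by [].
  rewrite -!mulmxA => -[-> ->]; rewrite -scalemxAr.
  have /(tAXY _ _ _) : cast_ord (tB p).1 i = cast_ord (tA (t'.1 p)).1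
    (cast_ord (tB p).1 i) :> nat by [].
  move=> [-> ->]; rewrite scalerA -signr_addb /= ffunE.
  have [|//|-> ->//] := nat_ord _ _ (cast_ord (tA (t'.1 p)).1
    (cast_ord (tB p).1 i)) j.
  by rewrite /= permM.
- split; first exact: isotropy_unit HA.
  apply/Gamma_liftP; split; first exact: isotropyV.
  (* The inverse carries at q the sign that [A] attaches to the preimage of q. *)
  exists ((t.1)^-1%g, [ffun p => t.2 (t.1^-1%g p)]); split=> [q|q i j ij] /=.
    rewrite ffunE; have [rq AZ] := tA (t.1^-1%g q).
    rewrite permKV in rq AZ; split=> //.
    by rewrite -[Zw q](signZK (t.2 (t.1^-1%g q))) -AZ -scalemxAr (isotropyK _ HA).
  rewrite ffunE; set p := t.1^-1%g q.
  have [AX AY] := tAXY p j (cast_ord (tA p).1 j) erefl.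
  have [||<- <-] := nat_ord _ _ (cast_ord (tA p).1 j) i; rewrite ?permKV//.
  split; first by rewrite -AX (isotropyK _ HA).
  by rewrite -[Y (t.1 p) _](signZK (t.2 p)) -AY -scalemxAr (isotropyK _ HA).
Qed.

(** * H0 as a product of unitary groups *)

Lemma form_mulmx p (M N : 'M[R[i]]_(r p)) (w w' : 'cV[R[i]]_(r p)) :
  (M *m w)^t* *m (N *m w') = w^t* *m (M^t* *m N) *m w'.
Proof. by rewrite trmx_mul map_mxM !mulmxA. Qed.

(** Zero on the center, as tangent vectors to H0 are; [unitary_act] adds the identity there and
    yields the group elements. *)
Definition block_act (u : forall p, 'M[R[i]]_(r p)) : 'M[R]_n :=
  linfun_mx (fun x => \sum_p fromC (u p *m coords p x)).

Lemma block_actE u x : block_act u *m x = \sum_p fromC (u p *m coords p x).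
Proof.
rewrite linfun_mxE// => a y z; rewrite scaler_sumr -big_split.
apply: eq_bigr => p _ /=.
by rewrite coordsP// mulmxDr -scalemxAr fromCP.
Qed.

Lemma coords_block_act u p x : coords p (block_act u *m x) = u p *m coords p x.
Proof.
by rewrite block_actE (coords_sum_fromC ip_inner XY_orthonormal p
  (fun p => u p *m coords p x)).
Qed.

Lemma block_actP (c : R) u v :
  block_act (fun p => c%:C *: u p + v p) = c *: block_act u + block_act v.
Proof.
apply: col_mx_inj => x; rewrite mulmxDl -scalemxAl !block_actE scaler_sumr -big_split.
by apply: eq_bigr => p _ /=; rewrite mulmxDl -scalemxAl fromCP.
Qed.

Definition unitary_act u := linfun_mx zpart + block_act u.

Lemma unitary_actE u x :
  unitary_act u *m x = zpart x + \sum_p fromC (u p *m coords p x).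
Proof. by rewrite mulmxDl linfun_mxE ?block_actE//; exact: zpart_linear. Qed.

Lemma unitary_act_center u z : (forall p, coords p z = 0) -> unitary_act u *m z = z.
Proof.
move=> z0; rewrite unitary_actE zpart_id// big1 ?addr0// => p _.
by rewrite z0 mulmx0 fromC0.
Qed.

Lemma coords_unitary_act u p x : coords p (unitary_act u *m x) = u p *m coords p x.
Proof.
rewrite mulmxDl coordsD// coords_block_act linfun_mxE; last exact: zpart_linear.
by rewrite coords_zpart// add0r.
Qed.

Lemma zpart_unitary_act u x : zpart (unitary_act u *m x) = zpart x.
Proof.
rewrite {1}/zpart unitary_actE -addrA -sumrB big1 ?addr0// => p _.
by rewrite -unitary_actE coords_unitary_act subrr.
Qed.

Lemma unitary_act_fromC u p (w : 'cV[R[i]]_(r p)) :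
  unitary_act u *m fromC w = fromC (u p *m w).
Proof.
rewrite unitary_actE (bigD1 p)//= coords_fromC//.
rewrite big1 => [|q qp]; last by rewrite coords_fromC_neq 1?eq_sym// mulmx0 fromC0.
rewrite addr0 /zpart (bigD1 p)//= coords_fromC// big1 => [|q qp].
  by rewrite addr0 subrr add0r.
by rewrite coords_fromC_neq 1?eq_sym// fromC0.
Qed.

Lemma unitary_actM u v :
  unitary_act (fun p => u p *m v p) = unitary_act u *m unitary_act v.
Proof.
apply: col_mx_inj => x; rewrite -mulmxA [RHS]unitary_actE zpart_unitary_act.
rewrite unitary_actE; congr (_ + _); apply: eq_bigr => p _.
by rewrite coords_unitary_act mulmxA.
Qed.

Lemma unitary_act_isometryP u :
  (forall x y, ip (unitary_act u *m x) (unitary_act u *m y) = ip x y) <->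
  (forall p, u p \is unitarymx).
Proof.
split=> [u_iso p|u_unitary x y]; last first.
  rewrite [LHS](ip_coords ip_inner XY_orthonormal).
  rewrite [RHS](ip_coords ip_inner XY_orthonormal).
  rewrite !zpart_unitary_act; congr (_ + _).
  apply: eq_bigr => p _; rewrite !coords_unitary_act form_mulmx.
  have := u_unitary p; rewrite -trmxC_unitary => /unitarymxP; rewrite trmxCK => ->.
  by rewrite mulmx1.
rewrite -trmxC_unitary; apply/unitarymxP; rewrite trmxCK.
apply/eqP; rewrite -subr_eq0; apply/eqP; apply: mx_eq0_of_Re_form => w w'.
have := u_iso (fromC w) (fromC w').
rewrite !unitary_act_fromC !ip_fromC// !coords_fromC//.
rewrite form_mulmx mulmxBr mulmxBl mulmx1 => E.
by rewrite mxE [X in _ + X]mxE ReD ReN E subrr.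
Qed.

Lemma isotropy0_unitary_act u :
  (forall p, u p \is unitarymx) -> H0 (unitary_act u).
Proof.
move=> u_unitary; have u_iso := (unitary_act_isometryP u).2 u_unitary.
apply/isotropy0P; split=> [|p]; last exact: unitary_act_center.
split=> //; first exact: ip_isometry_unitmx u_iso.
move=> x y; rewrite unitary_act_center; last first.
  by move=> p; exact: coords_br.
rewrite !brE; apply: eq_bigr => p _; congr (_ *: _).
rewrite /omega !coords_unitary_act form_mulmx.
have := u_unitary p; rewrite -trmxC_unitary => /unitarymxP; rewrite trmxCK => ->.
by rewrite mulmx1.
Qed.

(** Only the images of the [X p j] are read; when [A] acts complex-linearly on the component, they
    determine those of the [Y p j]. *)
Definition mx_blocks A p : 'M[R[i]]_(r p) :=
  \matrix_(i, j) coords p (A *m X p j) i 0.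

Lemma mx_blocks_fromC A p (M : 'M[R[i]]_(r p)) :
  (forall w : 'cV[R[i]]_(r p), A *m fromC w = fromC (M *m w)) -> mx_blocks A p = M.
Proof.
move=> AM; apply/matrixP => i j; rewrite mxE -(fromC_delta X Y) AM coords_fromC//.
by rewrite -colE mxE.
Qed.

Lemma mx_blocks_unitary_act u p : mx_blocks (unitary_act u) p = u p.
Proof. by apply: mx_blocks_fromC => w; exact: unitary_act_fromC. Qed.

Lemma block_act_fromC u p (w : 'cV[R[i]]_(r p)) :
  block_act u *m fromC w = fromC (u p *m w).
Proof.
rewrite block_actE (bigD1 p)//= coords_fromC// big1 ?addr0 => [//|q qp].
by rewrite coords_fromC_neq 1?eq_sym// mulmx0 fromC0.
Qed.

Lemma mx_blocks_block_act u p : mx_blocks (block_act u) p = u p.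
Proof. by apply: mx_blocks_fromC => w; exact: block_act_fromC. Qed.

(** [A] fixes Z_p, so it commutes with [Jop (Zw p)], which on the p-th component is the complex
    structure times the nonzero scalar <Z_p, Z_p>. Hence [A] is complex-linear there. *)
Lemma isotropy0_fromC A p (w : 'cV[R[i]]_(r p)) : H0 A ->
  A *m fromC w = fromC (mx_blocks A p *m w).
Proof.
move=> /isotropy0P[HA AZ].
have A_fromC (w' : 'cV[R[i]]_(r p)) :
    A *m fromC w' = fromC (coords p (A *m fromC w')).
  exact: isotropy_fromC HA (or_introl (AZ p)).
have A_i (w' : 'cV[R[i]]_(r p)) :
    A *m fromC ('i *: w') = fromC ('i *: coords p (A *m fromC w')).
  have ZZ : ip (Zw p) (Zw p) != 0 by rewrite ip_eq0.
  apply: (scalerI ZZ); have := Jop_isotropy (Zw p) (fromC w') HA.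
  by rewrite Jop_fromC -scalemxAr AZ => ->; rewrite [in LHS]A_fromC Jop_fromC.
have -> : w = \sum_j w j 0 *: delta_mx j 0.
  by rewrite {1}(matrix_sum_delta w); apply: eq_bigr => j _; rewrite big_ord1.
rewrite fromC_sum [LHS]mulmx_sumr [X in fromC X]mulmx_sumr fromC_sum.
apply: eq_bigr => j _.
set c := w j 0; set d := delta_mx j 0.
have cE : c *: d = (complex.Re c)%:C *: d + (complex.Im c)%:C *: ('i *: d).
  rewrite scalerA -scalerDl; congr (_ *: _).
  by apply: complex_eq; rewrite /=; ring.
have colE' : mx_blocks A p *m d = coords p (A *m fromC d).
  by rewrite -colE fromC_delta; apply/colP => i; rewrite !mxE.
rewrite cE fromCP fromCZ mulmxDr -!scalemxAr A_i -colE' A_fromC -colE'.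
by rewrite mulmxDr -!scalemxAr fromCP fromCZ.
Qed.

Lemma isotropy0E A : H0 A -> unitary_act (mx_blocks A) = A.
Proof.
move=> HA; have /isotropy0P[_ AZ] := HA.
apply: eq_mx_of_generators => p.
- by rewrite AZ unitary_act_center.
- by move=> i; rewrite -(fromC_delta X Y) unitary_act_fromC -isotropy0_fromC.
- by move=> i; rewrite -(fromC_idelta X Y) unitary_act_fromC -isotropy0_fromC.
Qed.

Lemma isotropy0_unitary A p : H0 A -> mx_blocks A p \is unitarymx.
Proof.
move=> HA; move: p; apply/unitary_act_isometryP; rewrite isotropy0E// => x y.
by case: HA => HA _; exact: (isotropy_ip _ _ HA).
Qed.

(** * Compactness of H0 *)

(** Replaces the bracket and the center by an affine equation and the isometry condition. Both are
    closed, and both can be differentiated along a curve. *)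
Lemma isotropy0_blocksP A : H0 A <->
  A = linfun_mx zpart + block_act (mx_blocks A) /\
  forall x y, ip (A *m x) (A *m y) = ip x y.
Proof.
split=> [HA|[AE A_iso]].
  split; first by rewrite -/(unitary_act _) isotropy0E.
  by case: HA => HA _ x y; exact: (isotropy_ip _ _ HA).
rewrite AE -/(unitary_act _); apply: isotropy0_unitary_act.
by apply/unitary_act_isometryP; rewrite /unitary_act -AE.
Qed.

Lemma mx_blocksP (c : R) A B p :
  mx_blocks (c *: A + B) p = c%:C *: mx_blocks A p + mx_blocks B p.
Proof.
apply/matrixP => i j; rewrite [LHS]mxE mulmxDl -scalemxAl coordsP//.
by rewrite mxE [in RHS]mxE; congr (_ + _); rewrite ?mxE.
Qed.

(** This map is constant on H0, with value the matrix of [zpart]. Linearity makes that a closed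
    condition and forces the map to vanish on tangent vectors. *)
Lemma off_block_linear :
  linear (fun A : 'M[R]_n => A - block_act (mx_blocks A)).
Proof.
move=> a A B; rewrite scalerBr addrACA -opprD; congr (_ - _).
rewrite -block_actP; congr block_act.
by apply: functional_extensionality_dep => p; exact: mx_blocksP.
Qed.

Lemma ip_mulmx_continuous x y :
  continuous (fun A : 'M[R]_n => ip (A *m x) (A *m y)).
Proof.
have -> : (fun A : 'M[R]_n => ip (A *m x) (A *m y)) =
    fun A => \sum_i (A *m x) i 0 * ip (delta_mx i 0) (A *m y).
  apply/funext => A; rewrite {1}(matrix_sum_delta (A *m x)) ip_suml//.
  by apply: eq_bigr => i _; rewrite big_ord1 ipZl.
move=> A; apply: (@cvg_sumr _ R^o _ (nbhs A)) => i; apply: cvgM.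
  have f_lin : linear (fun B : 'M[R]_n => (B *m x) i 0 : R^o).
    by move=> a B C; rewrite mulmxDl -scalemxAl !mxE.
  exact: (linear_mx_continuous f_lin).
have f_lin : linear (fun B : 'M[R]_n => ip (delta_mx i 0) (B *m y) : R^o).
  by move=> a B C; rewrite mulmxDl -scalemxAl ipPr.
exact: (linear_mx_continuous f_lin).
Qed.

Lemma closed_isotropy0 : closed H0.
Proof.
pose L A := A - block_act (mx_blocks A).
have -> : H0 = L @^-1` [set linfun_mx zpart] `&`
    \bigcap_(xy in [set: 'cV[R]_n * 'cV[R]_n])
      (fun A => ip (A *m xy.1) (A *m xy.2)) @^-1` [set ip xy.1 xy.2].
  apply/seteqP; split=> [A /isotropy0_blocksP[AE A_iso]|A [AE A_iso]].
    split=> [|[x y] _]; last exact: A_iso.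
    by rewrite /= /L {1}AE addrK.
  apply/isotropy0_blocksP; split=> [|x y]; last exact: (A_iso (x, y)).
  by rewrite -[X in X + _]AE subrK.
apply: closedI; [|apply: closed_bigI => -[x y] _]; apply: closed_comp.
- by move=> A _; apply: linear_mx_continuous; exact: off_block_linear.
- exact/accessible_closed_set1/hausdorff_accessible/norm_hausdorff.
- by move=> A _; exact: ip_mulmx_continuous.
- exact/accessible_closed_set1/hausdorff_accessible/norm_hausdorff.
Qed.

Lemma compact_isotropy0 : compact H0.
Proof.
(* By Cauchy-Schwarz a coefficient t >= 0 satisfies t^2 <= <e_j, e_j>, and t <= t^2 + 1; the summand
   1 avoids a square root. *)
pose c j := ip (delta_mx j 0) (delta_mx j 0) + 1.
pose C i j : R := `|zpart (delta_mx j 0) i 0| +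
  \sum_p \sum_(l < r p) (c j * `|X p l i 0| + c j * `|Y p l i 0|).
apply: (@bounded_closed_compact_mx _ _ _ _ C); first exact: closed_isotropy0.
move=> A HA i j.
have A_bound v : ip v v = 1 -> `|ip (A *m delta_mx j 0) v| <= c j.
  move=> v1; have := cauchy_schwarz ip_inner (A *m delta_mx j 0) v.
  case: (HA) => HA' _; rewrite v1 mulr1 (isotropy_ip _ _ HA').
  rewrite -real_normK ?num_real//.
  set t := `|_|; have t0 : 0 <= t by exact: normr_ge0.
  by rewrite /c; nra.
have -> : A i j = zpart (delta_mx j 0) i 0 + \sum_p \sum_(l < r p)
    (ip (A *m delta_mx j 0) (X p l) * X p l i 0 +
     ip (A *m delta_mx j 0) (Y p l) * Y p l i 0).
  transitivity ((A *m delta_mx j 0 : 'cV[R]_n) i 0); first by rewrite -colE mxE.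
  rewrite {1}(zpartK ip X Y (A *m delta_mx j 0)) -{1}(isotropy0E HA).
  rewrite zpart_unitary_act mxE summxE; congr (_ + _); apply: eq_bigr => p _.
  by rewrite summxE; apply: eq_bigr => l _; rewrite !mxE.
apply: le_trans (ler_normD _ _) _; rewrite lerD2l.
apply: le_trans (ler_norm_sum _ _ _) _; apply: ler_sum => p _.
apply: le_trans (ler_norm_sum _ _ _) _; apply: ler_sum => l _.
apply: le_trans (ler_normD _ _) _.
by rewrite !normrM lerD// ler_wpM2r// A_bound ?ip_X ?ip_Y.
Qed.

(** * One-parameter curves and connectedness of H0 *)

Definition block1 p (M : 'M[R[i]]_(r p)) : 'M[R]_n :=
  linfun_mx (fun x => fromC (M *m coords p x)).

Lemma block1E p (M : 'M[R[i]]_(r p)) x : block1 M *m x = fromC (M *m coords p x).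
Proof.
rewrite linfun_mxE// => a y z.
by rewrite coordsP// mulmxDr -scalemxAr fromCP.
Qed.

Lemma block_act_sum u : block_act u = \sum_p block1 (u p).
Proof.
apply: col_mx_inj => x; rewrite block_actE mulmx_suml.
by apply: eq_bigr => p _; rewrite block1E.
Qed.

Lemma block1_sum p I (s : seq I) (P : pred I) (M : I -> 'M[R[i]]_(r p)) :
  block1 (\sum_(i <- s | P i) M i) = \sum_(i <- s | P i) block1 (M i).
Proof.
apply: col_mx_inj => x; rewrite block1E !mulmx_suml fromC_sum.
by apply: eq_bigr => i _; rewrite block1E.
Qed.

(** The target consists of real matrices, so a complex scalar becomes two real coefficients, with
    the complex structure absorbed into the second block. *)
Lemma block1Z p (c : R[i]) (M : 'M[R[i]]_(r p)) : block1 (c *: M) =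
  complex.Re c *: block1 M + complex.Im c *: block1 ('i *: M).
Proof.
apply: col_mx_inj => x.
have scaleE a (M' : 'M[R[i]]_(r p)) :
    (a *: block1 M') *m x = fromC (a%:C *: (M' *m coords p x)).
  by rewrite -scalemxAl block1E fromCZ.
rewrite [RHS]mulmxDl !scaleE -fromCD block1E; congr (fromC _).
rewrite -!scalemxAl scalerA -scalerDl; congr (_ *: _).
by apply: complex_eq; rewrite /=; ring.
Qed.

Section Curve.
Variables (w : forall p, 'M[R[i]]_(r p)) (theta : forall p, 'I_(r p) -> R).
Hypothesis w_unitary : forall p, w p \is unitarymx.

Definition torus_curve (t : R) : 'M[R]_n := unitary_act (fun p =>
  spectral_form (w p) (fun j => cos (t * theta j) +i* sin (t * theta j))).

Lemma torus_curve_isotropy0 t : H0 (torus_curve t).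
Proof.
apply: isotropy0_unitary_act => p; apply: spectral_form_unitary => // j.
apply: complex_eq; rewrite /= ?mulrN ?opprK -?expr2 ?cos2Dsin2//.
by rewrite mulrC addNr.
Qed.

Lemma torus_curve0 : torus_curve 0 = 1%:M.
Proof.
have : H0 1%:M by case: (normal_in_isotropy0 ip br0) => -[].
move=> /isotropy0E <-; rewrite /torus_curve; congr unitary_act.
apply: functional_extensionality_dep => p; apply/esym; apply: mx_blocks_fromC => v.
rewrite mul1mx; congr (fromC _).
rewrite /spectral_form [diag_mx _](_ : _ = 1%:M).
  have := w_unitary p; rewrite mulmx1 -trmxC_unitary => /unitarymxP.
  by rewrite trmxCK => ->; rewrite mul1mx.
by apply/matrixP => i j; rewrite !mxE mul0r cos0 sin0.
Qed.

(** The derivative at an arbitrary t provides continuity of the curve; its value at 0 is the tangent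
    vector realised by the curve. *)
Lemma torus_curve_is_derive (t : R) : exists D, is_derive t 1 torus_curve D /\
  (t = 0 -> D = block_act (fun p =>
    spectral_form (w p) (fun j => 0 +i* theta j))).
Proof.
pose B p (j : 'I_(r p)) := block1 ((w p)^t* *m delta_mx j j *m w p).
pose C p (j : 'I_(r p)) := block1 ('i *: ((w p)^t* *m delta_mx j j *m w p)).
have curveE : torus_curve = fun t => linfun_mx zpart + \sum_p \sum_(j < r p)
    (cos (t * theta j) *: B p j + sin (t * theta j) *: C p j).
  apply/funext => s; rewrite /torus_curve /unitary_act; congr (_ + _).
  rewrite block_act_sum; apply: eq_bigr => p _.
  by rewrite spectral_formE block1_sum; apply: eq_bigr => j _; rewrite block1Z.
exists (0 + \sum_p \sum_(j < r p) ((- sin (t * theta j) * theta j) *: B p j +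
  (cos (t * theta j) * theta j) *: C p j)); split.
  rewrite curveE; apply: is_deriveD.
  apply: is_derive_bigsum => p; apply: is_derive_bigsum => j.
  exact: is_derive_trig.
move=> ->; rewrite add0r block_act_sum; apply: eq_bigr => p _.
rewrite spectral_formE block1_sum; apply: eq_bigr => j _; rewrite block1Z /=.
by rewrite mul0r sin0 cos0 oppr0 mul0r mul1r.
Qed.

End Curve.

Lemma isotropy0_torus_curve A : H0 A -> exists w theta,
  (forall p, w p \is unitarymx) /\ torus_curve w theta 1 = A.
Proof.
move=> HA.
have spec p : exists wt : 'M[R[i]]_(r p) * ('I_(r p) -> R),
    wt.1 \is unitarymx /\ mx_blocks A p =
      spectral_form wt.1 (fun j => cos (wt.2 j) +i* sin (wt.2 j)).
  have [w [theta wt]] := unitary_spectral (isotropy0_unitary p HA).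
  by exists (w, theta).
have [wt wtP] := all_sig (fun p => cid (spec p)).
exists (fun p => (wt p).1), (fun p => (wt p).2).
split=> [p|]; first by have [] := wtP p.
rewrite -[RHS](isotropy0E HA); congr unitary_act.
apply: functional_extensionality_dep => p; have [_ ->] := wtP p.
by congr spectral_form; apply/funext => j; rewrite mul1r.
Qed.

(** H0 is a union of continuous images of the line which all pass through the identity at time 0. *)
Lemma connected_isotropy0 : connected H0.
Proof.
pose P := [set wt : (forall p, 'M[R[i]]_(r p)) * (forall p, 'I_(r p) -> R) |
  forall p, wt.1 p \is unitarymx].
have -> : H0 = \bigcup_(wt in P) (torus_curve wt.1 wt.2 @` [set: R]).
  apply/seteqP; split=> [A /isotropy0_torus_curve[w [theta [w_unitary <-]]]|A].
    by exists (w, theta) => //; exists 1.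
  by move=> [wt w_unitary [t _ <-]]; exact: torus_curve_isotropy0.
apply: bigcup_connected => [|wt w_unitary].
  by exists 1%:M => wt w_unitary; exists 0 => //; exact: torus_curve0.
apply: connected_continuous_connected; first exact/connected_intervalP.
apply: continuous_subspaceT => t.
have [D [dD _]] := torus_curve_is_derive wt.1 wt.2 t.
exact: is_derive_continuous dD.
Qed.

(* An element of H moves Z_p within the finite set of the +-Z_q. *)
Lemma near_isotropy0 A : H0 A -> \forall B \near A, H B -> H0 B.
Proof.
move=> /isotropy0P[HA AZ]; have nA : Filter (nbhs A) by exact: nbhs_filter.
have : \forall B \near A, forall p q (e : bool),
    (-1) ^+ e *: Zw q != Zw p -> B *m Zw p <> (-1) ^+ e *: Zw q.
  apply: (filter_forall nA) => p.
  apply: (filter_forall nA) => q.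
  apply: (filter_forall nA) => e.
  have [->|qp] := eqVneq ((-1) ^+ e *: Zw q) (Zw p).
    by apply: (@filterS _ (nbhs A) nA _ _ _ filterT).
  have Z_lin : linear (fun B : 'M[R]_n => B *m Zw p).
    by move=> a B C; rewrite mulmxDl -scalemxAl.
  have Z_open : open (~` [set (-1) ^+ e *: Zw q]).
    exact/closed_openC/accessible_closed_set1/hausdorff_accessible/norm_hausdorff.
  have : nbhs (A *m Zw p) (~` [set (-1) ^+ e *: Zw q]).
    by apply: open_nbhs_nbhs; split=> //=; rewrite AZ => E; rewrite -E eqxx in qp.
  by move=> /(linear_mx_continuous Z_lin); apply: (@filterS _ (nbhs A)) => B /= BZ _.
apply: (@filterS _ (nbhs A)) => B B_near HB; apply/isotropy0P; split=> // p.
have [t /(_ p)[_ BZ]] := isotropy_acts_by HB.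
have [E|ne] := eqVneq ((-1) ^+ t.2 p *: Zw (t.1 p)) (Zw p); first by rewrite BZ E.
by have := B_near _ _ _ ne BZ.
Qed.

(** * The identity component of H *)

Lemma isotropy0_1 : H0 1%:M.
Proof. by case: (normal_in_isotropy0 ip br0) => -[]. Qed.

(** H0 is connected, closed, and relatively open in H by [near_isotropy0], so it meets the component
    of the identity in a nonempty clopen part. *)
Lemma component_isotropy : connected_component H 1%:M = H0.
Proof.
have H0_H : H0 `<=` H by move=> A [].
apply/seteqP; split; last first.
  apply: connected_component_max => //; first exact: isotropy0_1.
  exact: connected_isotropy0.
set C := connected_component _ _.
have CH : C `<=` H by exact: connected_component_sub.
suff <- : C `&` H0 = C by move=> A [].
apply: (@component_connected _ H 1%:M).
- exists 1%:M; split; last exact: isotropy0_1.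
  exact/connected_component_refl/H0_H/isotropy0_1.
(* Relative openness needs an open set of all matrices whose trace on the component is H0: the
   interior of those [B] for which H implies H0. *)
- exists [set B | H B -> H0 B]°; first exact: open_interior.
  apply/seteqP; split=> [A [CA /near_isotropy0]|A [CA /interior_subset HH0]].
    by split.
  by split=> //; apply: HH0; exact: CH.
- by exists H0 => //; exact: closed_isotropy0.
Qed.

(** * The Lie algebra of H and its dimension *)

Definition skew_family (v : forall p, 'M[R[i]]_(r p)) :=
  forall p, (v p)^t* = - v p.

(** A curve of H through the identity stays in H0 for small times. There the map of
    [off_block_linear] is constant, so it kills the difference quotients and their limit. The
    isometry condition, differentiated, makes the blocks skew-Hermitian. *)
Lemma lie_algebra_isotropy_block A : matrix_lie_algebra H A ->
  A = block_act (mx_blocks A) /\ skew_family (mx_blocks A).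
Proof.
move=> [gamma [gamma0 gammaH dgamma]].
have gamma_cont := is_derive_continuous dgamma.
pose D h := h^-1 *: (gamma (h + 0) - 1%:M).
have D_A : D h @[h --> (0 : R)^'] --> A.
  by move/is_deriveP : dgamma; rewrite gamma0.
have near_H0 : \forall h \near (0 : R)^', H0 (gamma h) /\ h != 0.
  have h_neq0 : \forall h \near (0 : R)^', h != 0 by exact: nbhs_dnbhs_neq.
  apply: filterS2 h_neq0 _ => [h h0 Hh|]; first by split; [exact: Hh|].
  have near0 : \forall h \near (0 : R), H (gamma h) -> H0 (gamma h).
    have N := near_isotropy0 isotropy0_1; rewrite -gamma0 in N.
    exact: (gamma_cont _ N).
  by apply: nbhs_dnbhs; apply: filterS near0 => h /(_ (gammaH h)).
have gammaE h : h != 0 -> gamma h = 1%:M + h *: D h.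
  by move=> h0; rewrite /D addr0 scalerA divff// scale1r addrC subrK.
pose L B := B - block_act (mx_blocks B).
have L_lin : linear L by exact: off_block_linear.
have L_H0 B : H0 B -> L B = linfun_mx zpart.
  by move=> /isotropy0_blocksP[BE _]; rewrite /L {1}BE addrK.
have A_block : A = block_act (mx_blocks A).
  apply/eqP; rewrite -subr_eq0 -/(L A); apply/eqP.
  apply: (@cvg_unique _ (@norm_hausdorff _ _) (L \o D @ (0 : R)^')).
    exact: cvg_comp D_A (linear_mx_continuous L_lin (x := A)).
  apply: cvg_near_cst; apply: filterS near_H0 => h [Hh h0] /=.
  have E := L_lin h (D h) 1%:M; rewrite [h *: D h + _]addrC -gammaE// in E.
  rewrite (L_H0 _ Hh) (L_H0 _ isotropy0_1) in E.
  apply: (scalerI h0); rewrite scaler0.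
  by apply: (addIr (linfun_mx zpart)); rewrite add0r -E.
split=> // p; apply/eqP; rewrite -addr_eq0; apply/eqP/mx_eq0_of_Re_form => w w'.
have A_skew x y : ip (A *m x) y + ip x (A *m y) = 0.
  (* Expanding the isometry condition for 1 + h D(h) and dividing by h gives q h = 0. The quadratic
     term keeps a factor h and disappears in the limit. *)
  pose q h := ip (D h *m x) y + ip x (D h *m y) + h * ip (D h *m x) (D h *m y).
  apply: (@cvg_unique _ (@norm_hausdorff _ _) (q @ (0 : R)^')); last first.
    apply: cvg_near_cst; apply: filterS near_H0 => h [[Hh _] h0].
    apply: (mulfI h0); rewrite mulr0 /q.
    have := isotropy_ip x y Hh; rewrite gammaE// !mulmxDl !mul1mx -!scalemxAl.
    rewrite !(ipDl ip_inner) !(ipDr ip_inner) !(ipZl ip_inner) !(ipZr ip_inner).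
    by move=> E; apply: (addrI (ip x y)); rewrite [RHS]addr0 -[RHS]E; ring.
  have -> : ip (A *m x) y + ip x (A *m y) =
      ip (A *m x) y + ip x (A *m y) + 0 * ip (A *m x) (A *m y) by rewrite mul0r addr0.
  apply: cvgD; first apply: cvgD.
  - have f_lin : linear (fun B : 'M[R]_n => ip (B *m x) y : R^o).
      by move=> a B C; rewrite mulmxDl -scalemxAl ipPl.
    exact: cvg_comp D_A (linear_mx_continuous f_lin (x := A)).
  - have f_lin : linear (fun B : 'M[R]_n => ip x (B *m y) : R^o).
      by move=> a B C; rewrite mulmxDl -scalemxAl ipPr.
    exact: cvg_comp D_A (linear_mx_continuous f_lin (x := A)).
  - apply: cvgM; first exact: nbhs_dnbhs.
    exact: cvg_comp D_A (@ip_mulmx_continuous x y A).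
have := A_skew (fromC w) (fromC w'); rewrite A_block !block_act_fromC.
rewrite !ip_fromC// !coords_fromC// -ReD trmx_mul map_mxM !mulmxA => E.
by rewrite mulmxDr mulmxDl mxE -[RHS]E mx_blocks_block_act.
Qed.

Lemma block_lie_algebra_isotropy v : skew_family v ->
  matrix_lie_algebra H (block_act v).
Proof.
move=> v_skew.
have spec p : exists wt : 'M[R[i]]_(r p) * ('I_(r p) -> R),
    wt.1 \is unitarymx /\ v p = spectral_form wt.1 (fun j => 0 +i* wt.2 j).
  have [w [theta wt]] := skew_spectral (v_skew p).
  by exists (w, theta).
have [wt wtP] := all_sig (fun p => cid (spec p)).
have w_unitary p : (wt p).1 \is unitarymx by have [] := wtP p.
exists (torus_curve (fun p => (wt p).1) (fun p => (wt p).2)); split.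
- exact: torus_curve0.
- by move=> t; case: (torus_curve_isotropy0 (fun p => (wt p).2) w_unitary t).
- have [D [dD /(_ erefl) DE]] :=
    torus_curve_is_derive (fun p => (wt p).1) (fun p => (wt p).2) 0.
  suff -> : block_act v = D by [].
  rewrite DE; congr block_act; apply: functional_extensionality_dep => p.
  by have [_ ->] := wtP p.
Qed.

(** One real parameter per entry of each block: their number is the sum of the r_p^2. *)
Let T : finType := {p : 'I_k & ('I_(r p) * 'I_(r p))%type}.
Let entry (g : 'rV[R]_#|T|) p (i j : 'I_(r p)) : R :=
  g 0 (enum_rank (Tagged (fun p => ('I_(r p) * 'I_(r p))%type) (i, j))).

(* The real and imaginary parts are the antisymmetric and symmetric parts of an
   arbitrary real matrix. *)
Let skew_of (g : 'rV[R]_#|T|) p : 'M[R[i]]_(r p) :=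
  \matrix_(i, j) ((entry g i j - entry g j i) +i* (entry g i j + entry g j i)).

Lemma skew_of_skew g : skew_family (skew_of g).
Proof.
move=> p; apply/matrixP => i j; rewrite !mxE.
by apply: complex_eq; rewrite /= ?opprB// addrC.
Qed.

Lemma skew_of_surj v : skew_family v -> exists g, forall p, skew_of g p = v p.
Proof.
move=> v_skew.
(* For a skew-Hermitian block the real part is antisymmetric and the imaginary part symmetric; half
   their sum has them as difference and sum with its transpose. *)
pose g : 'rV[R]_#|T| := \row_l let t := enum_val l in
  let c := v (tag t) (tagged t).1 (tagged t).2 in
  (complex.Re c + complex.Im c) / 2.
exists g => p; apply/matrixP => i j; rewrite mxE /entry !mxE !enum_rankK /=.
have /matrixP/(_ j i) := v_skew p; rewrite !mxE.
case: (v p i j) (v p j i) => a b [c d] /= [-> /eqP].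
rewrite eqr_opp => /eqP ->.
by apply: complex_eq => /=; field.
Qed.

Lemma skew_of_inj g : (forall p, skew_of g p = 0) -> g = 0.
Proof.
move=> g0; apply/rowP => l; rewrite mxE -(enum_valK l).
case: (enum_val l) => p [i j].
have /matrixP/(_ i j) := g0 p; rewrite !mxE => -[].
by rewrite -/(entry g i j); lra.
Qed.

(** The Lie algebra is the image of the parameter space under an injective linear map. *)
Lemma has_lie_dim_isotropy : has_lie_dim H (\sum_(p < k) r p ^ 2)%N.
Proof.
pose f g := block_act (skew_of g).
have f_lin : linear f.
  move=> a g g'; rewrite /f -block_actP; congr block_act.
  apply: functional_extensionality_dep => p; apply/matrixP => i j.
  by rewrite !mxE /entry !mxE; apply: complex_eq; rewrite /=; ring.
pose fL : {linear 'rV[R]_#|T| -> 'M[R]_n} :=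
  HB.pack f (GRing.isLinear.Build _ _ _ _ f f_lin).
exists (limg (linfun fL)).
  move=> A; split=> [/memv_imgP[g _ ->]|/lie_algebra_isotropy_block[AE v_skew]].
    by rewrite lfunE; exact/block_lie_algebra_isotropy/skew_of_skew.
  have [g gE] := skew_of_surj v_skew; apply/memv_imgP; exists g; first exact: memvf.
  have {}AE : A = f g.
    rewrite AE /f; congr block_act.
    by apply: functional_extensionality_dep => p; rewrite gE.
  by rewrite lfunE.
rewrite limg_dim_eq.
  rewrite dimvf dim_matrix -[LHS]/(1 * #|T|)%N mul1n.
  rewrite card_tagged sumnE big_map big_enum /=.
  by apply: eq_bigr => p _; rewrite card_prod card_ord mulnn.
apply/eqP; rewrite -subv0; apply/subvP => g; rewrite memv_cap => /andP[_].
rewrite memv_ker lfunE memv0 /= => /eqP fg; apply/eqP/skew_of_inj => p.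
rewrite -(mx_blocks_block_act (skew_of g)) -/(f g) fg.
by apply/matrixP => i j; rewrite [LHS]mxE mul0mx coords0// !mxE.
Qed.

(** * The homeomorphism with the product of unitary groups *)

Lemma block1_entries p (M : 'M[R[i]]_(r p)) : block1 M = \sum_i \sum_j
  (complex.Re (M i j) *: block1 (delta_mx i j : 'M[R[i]]_(r p)) +
   complex.Im (M i j) *: block1 ('i *: delta_mx i j : 'M[R[i]]_(r p))).
Proof.
rewrite {1}(matrix_sum_delta M) block1_sum; apply: eq_bigr => i _.
by rewrite block1_sum; apply: eq_bigr => j _; rewrite block1Z.
Qed.

(** The map is, up to a constant, a finite combination of fixed real matrices whose coefficients are
    real and imaginary parts of entries, continuous for the product topology. *)
Lemma unitary_act_continuous :
  continuous (unitary_act : cmx_family R r -> 'M[R]_n).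
Proof.
move=> u; have uF : Filter (nbhs u) by exact: nbhs_filter.
have -> : (unitary_act : cmx_family R r -> 'M[R]_n) = fun u => linfun_mx zpart +
    \sum_p \sum_i \sum_j
      (complex.Re ((u p : 'M[R[i]]_(r p)) i j) *: block1 (delta_mx i j) +
       complex.Im ((u p : 'M[R[i]]_(r p)) i j) *: block1 ('i *: delta_mx i j)).
  apply/funext => v; rewrite /unitary_act block_act_sum; congr (_ + _).
  by apply: eq_bigr => p _; exact: block1_entries.
have entry_cvg p i j : (v p i j : R[i]^o) @[v --> u] --> (u p i j : R[i]^o).
  have proj_cvg : (v p : 'M[R[i]^o]_(r p)) @[v --> u] --> (u p : 'M[R[i]^o]_(r p)).
    exact: (@proj_continuous _ (fun p => 'M[R[i]^o]_(r p)) p u).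
  exact: cvg_comp proj_cvg (@mx_entry_continuous _ _ _ i j (u p)).
apply: cvgD; first exact: cvg_cst.
apply: (@cvg_sumr _ _ _ (nbhs u)) => p; apply: (@cvg_sumr _ _ _ (nbhs u)) => i.
apply: (@cvg_sumr _ _ _ (nbhs u)) => j; apply: cvgD; apply: cvgZr_tmp.
  exact: cvg_comp (entry_cvg p i j) (@Re_continuous R (u p i j)).
exact: cvg_comp (entry_cvg p i j) (@Im_continuous R (u p i j)).
Qed.

Lemma mx_blocks_continuous :
  continuous (mx_blocks : 'M[R]_n -> cmx_family R r).
Proof.
move=> A; have AF : Filter (nbhs A) by exact: nbhs_filter.
apply: (@cvg_prod_topology _ (nbhs A)) => p; apply: (@cvg_mx _ (nbhs A)) => i j.
have f_lin v v' : linear (fun B : 'M[R]_n => ip (B *m v) v' : R^o).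
  by move=> a B C; rewrite mulmxDl -scalemxAl ipPl.
apply: (@cvg_complex _ _ (nbhs A)).
  have -> : (fun B : 'M[R]_n => complex.Re (mx_blocks B p i j)) =
      (fun B => ip (B *m X p j) (X p i)) by apply/funext => B; rewrite !mxE.
  by rewrite !mxE; exact: (linear_mx_continuous (f_lin _ _)).
have -> : (fun B : 'M[R]_n => complex.Im (mx_blocks B p i j)) =
    (fun B => ip (B *m X p j) (Y p i)) by apply/funext => B; rewrite !mxE.
by rewrite !mxE; exact: (linear_mx_continuous (f_lin _ _)).
Qed.

Lemma isotropy0_acts_as_unitary_product :
  acts_as_unitary_product X Y (lie_center br) H0.
Proof.
have actK (u : cmx_family R r) : mx_blocks (unitary_act u) = u.
  by apply: functional_extensionality_dep => p; exact: mx_blocks_unitary_act.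
exists (unitary_act : cmx_family R r -> 'M[R]_n), mx_blocks; split.
- split.
  + split=> [u u_unitary|u v _ _ uv|A HA].
    * exact: isotropy0_unitary_act.
    * by rewrite -(actK u) -(actK v) uv.
    * exists (mx_blocks A); last exact: isotropy0E.
      by move=> p; exact: isotropy0_unitary.
  + by move=> u _; exact: actK.
  + by apply: continuous_subspaceT; exact: unitary_act_continuous.
  + by apply: continuous_subspaceT; exact: mx_blocks_continuous.
- by move=> u v _ _; exact: unitary_actM.
- by move=> u p w _; exact: unitary_act_fromC.
- by move=> u z _ /lie_centerP z0; exact: unitary_act_center.
Qed.

End WeightModel.

(** * The bracket in terms of the weights *)

Section IsotypicModel.
Variables (R : realType) (n : nat) (br : 'cV[R]_n -> 'cV[R]_n -> 'cV[R]_n).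
Variable ip : 'cV[R]_n -> 'cV[R]_n -> R.
Hypothesis ip_inner : inner_product ip.
Hypothesis br_skew : forall x y, br x y = - br y x.
Hypothesis br_linear : forall a x x' y,
  br (a *: x + x') y = a *: br x y + br x' y.
Hypothesis center_derived : lie_center br = lie_derived br.
Variable J : 'cV[R]_n -> 'cV[R]_n -> 'cV[R]_n.
Hypothesis J_Jmap : is_Jmap br ip J.
Variables (k : nat) (r : 'I_k -> nat).
Variables (X Y : forall p : 'I_k, 'I_(r p) -> 'cV[R]_n).
Arguments X : clear implicits.
Arguments Y : clear implicits.
Variable lam : 'I_k -> 'cV[R]_n -> R.
Hypothesis decomposition : isotypic_decomposition br ip J X Y lam.
Variable Zw : 'I_k -> 'cV[R]_n.
Hypothesis Zw_weight : is_weight_vector br ip lam Zw.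
Implicit Types (x y z : 'cV[R]_n) (a : R) (p q : 'I_k).
Local Notation fromC := (from_complex X Y).
Local Notation coords := (coords ip X Y).
Local Notation zpart := (zpart ip X Y).
Local Notation omega := (omega ip X Y).
Local Notation Jop := (Jop ip X Y Zw).
Local Notation center := (lie_center br).
Local Notation perp := (orthogonal_to ip (lie_center br)).

Lemma isotypic_orthonormal p (i : 'I_(r p)) q (j : 'I_(r q)) :
  let delta : R := ((p == q) && (i == j :> nat))%:R in
  [/\ ip (X p i) (X q j) = delta, ip (Y p i) (Y q j) = delta &
      ip (X p i) (Y q j) = 0].
Proof. by case: decomposition. Qed.
Let XY_on := isotypic_orthonormal.

Lemma perp_linear a x y : perp x -> perp y -> perp (a *: x + y).
Proof. by move=> px py z zc; rewrite ipPl// px// py// mulr0 addr0. Qed.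

Lemma perp_XY p i : perp (X p i) /\ perp (Y p i).
Proof.
have [_ perpE _ _ _] := decomposition.
suff sub v : v \in (<[X p i]> + <[Y p i]>)%VS -> perp v.
  split; apply: sub; first exact: subvP (addvSl _ _) _ (memv_line _).
  exact: subvP (addvSr _ _) _ (memv_line _).
move=> v_in; apply/perpE; apply: subvP v_in.
apply: (subv_trans _ (sumv_sup p _ (subvv _))) => //.
exact: (sumv_sup i).
Qed.

Lemma perp_fromC p (w : 'cV[R[i]]_(r p)) : perp (fromC w).
Proof.
have perp0 : perp 0 by move=> z _; rewrite ip0l.
rewrite /from_complex; elim/big_ind : _ => // [x y px py|i _].
  by rewrite -[x]scale1r; exact: perp_linear.
have [pX pY] := perp_XY i; apply: perp_linear => //.
by rewrite -[_ *: _]addr0; exact: perp_linear.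
Qed.

Lemma coords_center z : center z -> forall p, coords p z = 0.
Proof.
move=> zc p; apply/colP => i; have [pX pY] := perp_XY i.
by rewrite !mxE !(ipC ip_inner z) pX// pY.
Qed.

Lemma zpart_perp x : perp x -> zpart x = 0.
Proof.
have [_ perpE _ _ _] := decomposition; move=> /perpE x_in.
pose zL : {linear 'cV[R]_n -> 'cV[R]_n} :=
  HB.pack zpart (GRing.isLinear.Build _ _ _ _ zpart (zpart_linear ip_inner X Y)).
suff /subvP/(_ _ x_in) : (\sum_(p < k) \sum_(i < r p)
    (<[X p i]> + <[Y p i]>) <= lker (linfun zL))%VS.
  by rewrite memv_ker lfunE => /eqP.
have zpart_fromC p (w : 'cV[R[i]]_(r p)) : zpart (fromC w) = 0.
  rewrite /zpart (bigD1 p)//= coords_fromC// big1 ?addr0 ?subrr// => q qp.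
  by rewrite coords_fromC_neq 1?eq_sym// fromC0.
apply/subv_sumP => p _; apply/subv_sumP => i _; rewrite subv_add -!memvE.
rewrite !memv_ker !lfunE /= -(fromC_delta X Y) -(fromC_idelta X Y).
by rewrite !zpart_fromC eqxx.
Qed.

Lemma br_central_r x z : center z -> br x z = 0.
Proof. by move=> zc; rewrite br_skew zc oppr0. Qed.

Lemma br_linear_r a x y y' : br x (a *: y + y') = a *: br x y + br x y'.
Proof. by rewrite br_skew br_linear opprD -scalerN -!(br_skew x). Qed.

Lemma center_linear a x y : center x -> center y -> center (a *: x + y).
Proof. by move=> xc yc u; rewrite br_linear xc yc scaler0 addr0. Qed.

Lemma center_br x y : center (br x y).
Proof.
rewrite center_derived; exists 1%N, (fun=> x), (fun=> y).
by rewrite big_ord1.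
Qed.

Lemma center0 : center 0.
Proof.
by rewrite -(addNr (br 0 0)) -scaleN1r; apply: center_linear; exact: center_br.
Qed.

(* Project x orthogonally onto z = [n, n]; the difference is perpendicular to z. *)
Lemma coords0_center x : (forall p, coords p x = 0) -> center x.
Proof.
move=> x0.
(* Brackets of standard basis vectors: a finite family that spans the derived algebra, as the
   projection requires. *)
pose s := [seq br (delta_mx i 0) (delta_mx j 0) | i <- enum 'I_n, j <- enum 'I_n].
have [|||w [w_center w_orth _]] :=
    orthogonal_projection_exists ip_inner (S := center) (s := s) _ _ _ x.
- exact: center0.
- exact: center_linear.
- by move=> v /allpairsP[[i j] [_ _ ->]]; exact: center_br.
have w_br u v : ip (x - w) (br u v) = 0.
  have br_sum u' v' : br u' v' = \sum_i \sum_j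
      (u' i 0 * v' j 0) *: br (delta_mx i 0) (delta_mx j 0).
    have br_suml (F : 'I_n -> 'cV[R]_n) y : br (\sum_i F i) y = \sum_i br (F i) y.
      apply: (big_morph (br^~ y)) => [x1 x2|]; last exact: center0.
      by rewrite -[x1]scale1r br_linear !scale1r.
    have br_Z a u1 v1 : br (a *: u1) v1 = a *: br u1 v1.
      by rewrite -[a *: u1]addr0 br_linear center0 addr0.
    rewrite {1}(matrix_sum_delta u') br_suml; apply: eq_bigr => i _.
    rewrite big_ord1 br_Z br_skew {1}(matrix_sum_delta v') br_suml -sumrN scaler_sumr.
    by apply: eq_bigr => j _; rewrite big_ord1 br_Z -scalerN -br_skew scalerA.
  rewrite br_sum ip_sumr// big1// => i _; rewrite ip_sumr// big1// => j _.
  by rewrite ipZr// w_orth ?mulr0//; apply/allpairsP; exists (i, j); rewrite !mem_enum.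
have xw_perp : perp (x - w).
  move=> z; rewrite center_derived => -[l [u [v ->]]].
  by rewrite ip_sumr// big1.
(* x - w has no central part, being orthogonal to the center, and no coordinates, since neither x
   nor w has any. *)
suff -> : x = w by [].
apply/eqP; rewrite -subr_eq0 (zpartK ip X Y (x - w)) zpart_perp// add0r big1// => p _.
by rewrite coordsD// coordsN// x0 coords_center// subrr fromC0.
Qed.

Lemma Zw_lam p z : center z -> ip (Zw p) z = lam p z.
Proof. by have [_ + zc] := Zw_weight p; apply. Qed.

Lemma Zw_center p : center (Zw p). Proof. by case: (Zw_weight p). Qed.

Lemma coords_Zw p q : coords q (Zw p) = 0.
Proof. exact/coords_center/Zw_center. Qed.

Lemma JopP a x y z : Jop z (a *: x + y) = a *: Jop z x + Jop z y.
Proof.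
rewrite /Jop scaler_sumr -big_split; apply: eq_bigr => p _ /=.
have -> : 'i *: coords p (a *: x + y) =
    a%:C *: ('i *: coords p x) + 'i *: coords p y.
  by rewrite coordsP// scalerDr !scalerA mulrC.
by rewrite fromCP scalerDr !scalerA mulrC.
Qed.

Lemma Jop_X p i z : Jop z (X p i) = ip (Zw p) z *: Y p i.
Proof. by rewrite -(fromC_delta X Y) Jop_fromC// fromC_idelta. Qed.

Lemma Jop_Y p i z : Jop z (Y p i) = - ip (Zw p) z *: X p i.
Proof.
rewrite -(fromC_idelta X Y) Jop_fromC// scalerA.
have -> : 'i * 'i = (-1)%:C :> R[i] by apply: complex_eq; rewrite /=; ring.
by rewrite fromCZ fromC_delta scaleN1r scalerN scaleNr.
Qed.

Lemma Jop_perp z x : perp (Jop z x).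
Proof.
have perp0 : perp 0 by move=> y _; rewrite ip0l.
rewrite /Jop; elim/big_ind : _ => // [u v pu pv|p _].
  by rewrite -[u]scale1r; exact: perp_linear.
by rewrite -[_ *: _]addr0; apply: perp_linear => //; exact: perp_fromC.
Qed.

(** [J] is specified on vectors orthogonal to the center only, which restricts [y]. Linearity in [x]
    reduces to basis vectors, where [J] is given by the weights, and to central vectors, where both
    sides vanish. *)
Lemma ip_br_Jop z x y : center z -> perp y -> ip (br x y) z = ip (Jop z x) y.
Proof.
move=> zc py; elim/(vec_ind ip_inner XY_on) : x => [a x x' IH IH'|x x0|p i|p i].
- by rewrite br_linear JopP !ipPl// IH IH'.
- rewrite (coords0_center x0) ip0l// /Jop big1 ?ip0l// => p _.
  by rewrite x0 scaler0 fromC0 scaler0.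
- have [pX _] := perp_XY i; have [_ <-] := J_Jmap zc pX => //.
  have [_ _ _ _ /(_ p)[_ _ /(_ i z zc)[-> _]]] := decomposition.
  by rewrite Jop_X Zw_lam.
- have [_ pY] := perp_XY i; have [_ <-] := J_Jmap zc pY => //.
  have [_ _ _ _ /(_ p)[_ _ /(_ i z zc)[_ ->]]] := decomposition.
  by rewrite Jop_Y Zw_lam.
Qed.

Lemma J_Jop z x : center z -> perp x -> J z x = Jop z x.
Proof.
move=> zc px; have [pJ JE] := J_Jmap zc px.
have p_sub : perp (J z x - Jop z x).
  by rewrite addrC -scaleN1r; apply: perp_linear => //; exact: Jop_perp.
apply/eqP; rewrite -subr_eq0 -(ip_eq0 ip_inner).
by rewrite {1}ipBl// JE// -ip_br_Jop// subrr.
Qed.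

(** Both sides are central, so their difference d is tested against itself. Beforehand [y] is
    replaced by its part orthogonal to the center, to which [ip_br_Jop] applies. *)
Lemma isotypic_brE x y : br x y = \sum_p omega p x y *: Zw p.
Proof.
set y' := \sum_p fromC (coords p y).
have y'_perp : perp y'.
  rewrite /y'; elim/big_ind : _ => [z _|u v pu pv|p _]; first by rewrite ip0l.
    by rewrite -[u]scale1r; exact: perp_linear.
  exact: perp_fromC.
have zpart_center : center (zpart y).
  by apply: coords0_center => p; exact: coords_zpart.
have -> : br x y = br x y'.
  rewrite {1}(zpartK ip X Y y) -/y' -[zpart y]scale1r br_linear_r.
  by rewrite br_central_r// scaler0 add0r.
apply/eqP; rewrite -subr_eq0 -(ip_eq0 ip_inner); set d := _ - _.
have dc : center d.
  rewrite /d addrC -scaleN1r; apply: center_linear; last exact: center_br.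
  elim/big_ind : _ => [|u v uc vc|p _]; first exact: center0.
    by rewrite -[u]scale1r; exact: center_linear.
  rewrite -[_ *: _]addr0; apply: center_linear; [exact: Zw_center|exact: center0].
rewrite {1}/d ipBl// ip_br_Jop// [X in _ - X]ip_suml// subr_eq0; apply/eqP.
have -> : ip (Jop d x) y' = ip (Jop d x) y.
  rewrite [in RHS](zpartK ip X Y y) -/y' ipDr//.
  by rewrite [ip _ (zpart y)](Jop_perp d x zpart_center) add0r.
rewrite /Jop ip_suml//; apply: eq_bigr => p _.
by rewrite !ipZl// omega_ip// mulrC.
Qed.

Lemma isotypic_Zw_span z : (forall p, coords p z = 0) ->
  exists c : 'I_k -> R, z = \sum_p c p *: Zw p.
Proof.
move=> /coords0_center; rewrite center_derived => -[l [u [v ->]]].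
exists (fun p => \sum_i omega p (u i) (v i)).
under eq_bigr do rewrite isotypic_brE; rewrite exchange_big.
by apply: eq_bigr => p _; rewrite scaler_suml.
Qed.

Lemma isotypic_Zw_neq0 p : Zw p != 0.
Proof.
apply/eqP => Z0; have [_ _ _ _ /(_ p)[_ [z zc lamz] _]] := decomposition.
by apply: lamz; rewrite -Zw_lam// Z0 ip0l.
Qed.

Lemma isotypic_r_gt0 p : (0 < r p)%N.
Proof. by case: decomposition. Qed.

(** Equal or opposite weights give isomorphic modules, which the decomposition permits only within
    one isotypic component. *)
Lemma isotypic_Zw_inj p q : Zw p = Zw q \/ Zw p = - Zw q -> p = q.
Proof.
have [_ _ _ [_ iso] _] := decomposition => Zpq.
have [e e1 Ze] : exists2 e : R, e * e = 1 & Zw p = e *: Zw q.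
  case: Zpq => ->; [exists 1|exists (-1)]; rewrite ?mulrNN ?mulr1//.
    by rewrite scale1r.
  by rewrite scaleN1r.
have e_neq0 : e != 0 by apply: contra_eq_neq e1 => ->; rewrite mul0r eq_sym oner_eq0.
pose i := Ordinal (isotypic_r_gt0 p); pose j := Ordinal (isotypic_r_gt0 q).
apply/(iso p i q j).
(* Sends the basis X, Y of the first plane to X, e Y of the second: complex conjugation when e = -1,
   which compensates the opposite weight. *)
pose f x : 'cV[R]_n := ip x (X p i) *: X q j + ip x (Y p i) *: (e *: Y q j).
have f_lin : linear f.
  move=> a x y; rewrite /f !ipPl// !scalerDl !scalerDr -!scalerA.
  by rewrite addrACA.
pose fL : {linear 'cV[R]_n -> 'cV[R]_n} :=
  HB.pack f (GRing.isLinear.Build _ _ _ _ f f_lin).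
have [XX YY XY] := isotypic_orthonormal i i.
rewrite !eqxx in XX YY.
have fX : f (X p i) = X q j by rewrite /f XX XY scale1r scale0r addr0.
have fY : f (Y p i) = e *: Y q j by rewrite /f YY ipC// XY scale1r scale0r add0r.
have plane_mem x : x \in (<[X p i]> + <[Y p i]>)%VS ->
    exists a b : R, x = a *: X p i + b *: Y p i.
  by move=> /memv_addP[_ /vlineP[a ->] [_ /vlineP[b ->] ->]]; exists a, b.
exists (linfun fL); split.
- rewrite limgD !limg_line !lfunE /= fX fY; congr (_ + _)%VS.
  apply/eqP; rewrite eqEsubv -!memvE memvZ ?memv_line//=.
  by rewrite -{1}[Y q j](scalerK e_neq0) memvZ// memv_line.
- apply/eqP; rewrite -subv0; apply/subvP => x; rewrite memv_cap => /andP[].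
  move=> /plane_mem[a [b ->]]; rewrite memv_ker lfunE /= -[f _]/(fL _) linearP linearZ /=.
  rewrite fX fY scalerA memv0 => /eqP E.
  have [XX' YY' XY'] := isotypic_orthonormal j j.
  rewrite !eqxx in XX' YY'.
  have a0 : a = 0.
    have := congr1 (ip^~ (X q j)) E; rewrite ipPl// ipZl// XX'.
    by rewrite [ip (Y _ _) _]ipC// XY' mulr0 mulr1 addr0 ip0l.
  have : b * e = 0.
    have := congr1 (ip^~ (Y q j)) E; rewrite ipPl// ipZl// YY' XY'.
    by rewrite mulr0 mulr1 add0r ip0l.
  move/eqP; rewrite mulf_eq0 (negbTE e_neq0) orbF a0 => /eqP ->.
  by rewrite !scale0r addr0.
- move=> z x zc /plane_mem[a [b ->]]; have [pX pY] := perp_XY i.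
  have [pX' pY'] := perp_XY j.
  have Z_eq : ip (Zw p) z = e * ip (Zw q) z by rewrite Ze ipZl.
  have perpZ c u : perp u -> perp (c *: u).
    by move=> pu; rewrite -[c *: u]addr0; apply: perp_linear => // y _; rewrite ip0l.
  have JopZ c u : Jop z (c *: u) = c *: Jop z u.
    have Jop0 : Jop z 0 = 0.
      by rewrite /Jop big1// => s _; rewrite coords0// scaler0 fromC0 scaler0.
    by rewrite -[c *: u]addr0 JopP Jop0 addr0.
  have fLE a' b' : f (a' *: X p i + b' *: Y p i) = a' *: X q j + (b' * e) *: Y q j.
    by rewrite -[f _]/(fL _) linearP linearZ /= fX fY scalerA.
  rewrite !lfunE /= fLE J_Jop//; last by apply: perp_linear => //; exact: perpZ.
  rewrite J_Jop//; last by apply: perp_linear => //; exact: perpZ.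
  rewrite !JopP !JopZ !Jop_X !Jop_Y Z_eq !scalerA addrC fLE addrC.
  congr (_ *: _ + _ *: _); last by ring.
  by rewrite mulrA mulrAC -!mulrA [e * (e * _)]mulrA e1 mul1r.
Qed.

End IsotypicModel.

Theorem theorem4p1 (R : realType) (n : nat) (N : lie_group R n)
    (ip : 'cV[R]_n -> 'cV[R]_n -> R)
    (N_connected : connected [set: N])
    (N_simply_connected : simply_connected R N)
    (N_nilpotent : nilpotent_group N)
    (ip_inner : inner_product ip)
    (N_cyclic : cyclic N ip)
    (no_euclidean_factor :
       lie_center (lie_bracket N) = lie_derived (lie_bracket N))
    (J : 'cV[R]_n -> 'cV[R]_n -> 'cV[R]_n)
    (J_Jmap : is_Jmap (lie_bracket N) ip J)
    (k : nat) (r : 'I_k -> nat)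
    (X Y : forall p : 'I_k, 'I_(r p) -> 'cV[R]_n)
    (lam : 'I_k -> 'cV[R]_n -> R)
    (decomposition : isotypic_decomposition (lie_bracket N) ip J X Y lam)
    (Zw : 'I_k -> 'cV[R]_n)
    (Zw_weight : is_weight_vector (lie_bracket N) ip lam Zw) :
  let z := lie_center (lie_bracket N) in
  let H := isotropy (lie_bracket N) ip in
  let H0 := isotropy0 (lie_bracket N) ip in
  let GammaT := Gamma_lift (lie_bracket N) ip X Y Zw in
  [/\ H = [set A *m B | A in GammaT & B in H0],
      [/\ compact H0, connected H0, matrix_group H & normal_in H0 H],
      acts_as_unitary_product X Y z H0,
      matrix_group GammaT /\ finite_set GammaT &
      [/\ has_lie_dim H (\sum_(p < k) r p ^ 2)%N,
          connected_component H 1%:M = H0 &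
          quotient_embeds_in_signed_perms ip r Zw H H0]].
Proof.
move=> z H H0 GammaT.
have br_skew := @lie_bracketC R n N; have br_lin := @lie_bracket_linear R n N.
have XY_on := isotypic_orthonormal decomposition.
have r_gt0 := isotypic_r_gt0 decomposition.
have coords_Z := coords_Zw ip_inner decomposition Zw_weight.
have Z_span := isotypic_Zw_span ip_inner br_skew br_lin no_euclidean_factor
  J_Jmap decomposition Zw_weight.
have Z_neq0 := isotypic_Zw_neq0 ip_inner decomposition Zw_weight.
have Z_inj := isotypic_Zw_inj ip_inner br_skew br_lin no_euclidean_factor
  J_Jmap decomposition Zw_weight.
have brE := isotypic_brE ip_inner br_skew br_lin no_euclidean_factor
  J_Jmap decomposition Zw_weight.
have H_group := matrix_group_isotropy (lie_bracket N) ip.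
split.
- exact: isotropy_eq_lift_mul.
- split=> //.
  + exact: (compact_isotropy0 ip_inner XY_on coords_Z Z_span Z_neq0 Z_inj
      brE).
  + exact: (connected_isotropy0 ip_inner XY_on coords_Z Z_span Z_neq0 Z_inj
      brE).
  + exact/normal_in_isotropy0/(br0 ip_inner brE).
- exact: isotropy0_acts_as_unitary_product.
- split; [exact: matrix_group_Gamma_lift|exact: finite_Gamma_lift].
- split; last exact: isotropy_quotient.
    exact: (has_lie_dim_isotropy ip_inner XY_on r_gt0 coords_Z Z_span Z_neq0
      Z_inj brE).
  exact: (component_isotropy ip_inner XY_on r_gt0 coords_Z Z_span Z_neq0
    Z_inj brE).
Qed.
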